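(* Let $B$ be a separable Banach space, let $\mu,\nu,\mu_n,\nu_n\in\mathcal{P}_1(B)$ ($n\in\mathbb{N}$) with $\mu_n\to\mu$ and $\nu_n\to\nu$, let $\tilde\pi\in\mathcal{M}(\mu,\nu)$, and let $\pi_n\in\mathcal{M}(\mu_n,\nu_n)$ be such that $\pi_n\to\tilde\pi$, all convergences being in the Wasserstein-$1$ distance. Let $c:B\times B\to[0,\infty)$ be a continuous function with sub-linear growth, and set $$P_n:=\inf_{\pi\in\mathcal{M}(\mu_n,\nu_n)}\int c\,d\pi,\qquad P:=\inf_{\pi\in\mathcal{M}(\mu,\nu)}\int c\,d\pi.$$ Then $$\int c\,d\tilde\pi\;\geq\;\limsup_n P_n\;\geq\;\liminf_n P_n\;\geq\;P.$$ In particular, if $\tilde\pi$ is a minimiser of $\pi\mapsto\int c\,d\pi$ over $\mathcal{M}(\mu,\nu)$, then $P_n\to P$ along a minimising subsequence, i.e. $P_{n_k}\to P$ for any subsequence $(n_k)_k$ such that $P_{n_k}\to\liminf_n P_n$.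
   Context: $\mathcal{P}_1(B)$ is the set of Borel probability measures on $B$ with finite first moment, with the Wasserstein-1 distance $\mathcal{W}_1$ (and similarly on $B\times B$ with norm $\|(x,y)\|=\|x\|+\|y\|$). For $\mu,\nu\in\mathcal{P}_1(B)$, $\mathcal{M}(\mu,\nu)$ is the set of martingale couplings: Borel probabilities $\pi$ on $B\times B$ with first marginal $\mu$ and second marginal $\nu$ such that $\int g(x)(y-x)\,d\pi(x,y)=0$ for every bounded continuous $g:B\to\mathbb{R}$ (equivalently, $\pi$ is the law of a pair $(X,Y)$ with $X\sim\mu$, $Y\sim\nu$, $\mathbb{E}[Y|X]=X$). A function $c$ on $B\times B$ has sub-linear growth if there is $C\in\mathbb{R}$ with $|c(x,y)|\leq C(1+\|x\|+\|y\|)$ for all $x,y\in B$. *)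

(* Defs.v *)
From HB Require Import structures.
From mathcomp Require Import all_boot all_order all_algebra.
From mathcomp Require Import all_classical all_reals all_analysis.

Set Implicit Arguments.
Unset Strict Implicit.
Unset Printing Implicit Defensive.

Import Order.TTheory GRing.Theory Num.Theory.
Import numFieldNormedType.Exports.

Local Open Scope classical_set_scope.
Local Open Scope ring_scope.

(* For T := (B * B)%type this is the Borel sigma-algebra of the product
   topology, not the product sigma-algebra; the two agree when B is
   separable. *)
Notation borel T := (g_sigma_algebraType (@open T)).

Definition separable_space (T : topologicalType) : Prop :=
  exists D : set T, countable D /\ dense D.

Definition simple_function d (T : measurableType d) (V : Type)
    (s : T -> V) : Prop :=
  finite_set (range s) /\ forall v, measurable (s @^-1` [set v]).

Definition simple_integral d (T : measurableType d) (R : realType)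
    (V : normedModType R) (P : probability T R) (s : T -> V) : V :=
  \sum_(v \in range s) fine (P (s @^-1` [set v])) *: v.

(* [Bochner_integral P f v]: f is Bochner integrable with integral v. The
   a.e. convergence clause is the strong measurability of f; it is needed
   because \int is only a lower integral on non-measurable functions. *)
Definition Bochner_integral d (T : measurableType d) (R : realType)
    (V : normedModType R) (P : probability T R) (f : T -> V) (v : V) : Prop :=
  exists s : nat -> T -> V,
    [/\ forall n, simple_function (s n),
        {ae P, forall x, s n x @[n --> \oo] --> f x},
        (\int[P]_x `|f x - s n x|%:E)%E @[n --> \oo] --> 0%E
      & simple_integral P (s n) @[n --> \oo] --> v].

Definition couplings (R : realType) (T : ptopologicalType)
    (P Q : probability (borel T) R) :
    set (probability (borel (T * T)%type) R) :=
  [set gamma | forall A : set (borel T), measurable A ->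
    gamma (fst @^-1` A) = P A /\ gamma (snd @^-1` A) = Q A].

(* The norm N is a parameter because the norm that the library puts on
   (B * B)%type is the maximum of the norms of the components, whereas the
   norm of interest there is their sum. *)
Definition finite_first_moment (R : realType) (V : normedModType R)
    (N : V -> R) (P : probability (borel V) R) : Prop :=
  (\int[P]_x (N x)%:E < +oo)%E.

Definition wasserstein1 (R : realType) (V : normedModType R)
    (N : V -> R) (P Q : probability (borel V) R) : \bar R :=
  ereal_inf [set (\int[gamma]_z (N (z.1 - z.2))%:E)%E
            | gamma in couplings P Q].

Definition cvg_wasserstein1 (R : realType) (V : normedModType R)
    (N : V -> R) (P_ : nat -> probability (borel V) R)
    (P : probability (borel V) R) : Prop :=
  wasserstein1 N (P_ n) P @[n --> \oo] --> 0%E.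

Definition sum_norm (R : realType) (B : normedModType R)
    (z : (B * B)%type) : R := `|z.1| + `|z.2|.

Definition martingale_couplings (R : realType) (B : normedModType R)
    (mu nu : probability (borel B) R) :
    set (probability (borel (B * B)%type) R) :=
  [set pi | couplings mu nu pi /\
    forall g : B -> R, continuous g -> (exists M, forall x, `|g x| <= M) ->
      Bochner_integral pi (fun z => g z.1 *: (z.2 - z.1)) 0].

Definition sublinear_growth (R : realType) (B : normedModType R)
    (c : (B * B)%type -> R) : Prop :=
  exists C : R, forall x y : B, `|c (x, y)| <= C * (1 + `|x| + `|y|).

Definition cost (R : realType) (B : normedModType R)
    (c : (B * B)%type -> R) (pi : probability (borel (B * B)%type) R) :
    \bar R :=
  (\int[pi]_z (c z)%:E)%E.

Definition mot_value (R : realType) (B : normedModType R)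
    (c : (B * B)%type -> R) (mu nu : probability (borel B) R) : \bar R :=
  ereal_inf [set cost c pi | pi in martingale_couplings mu nu].

Definition mot_minimiser (R : realType) (B : normedModType R)
    (c : (B * B)%type -> R) (mu nu : probability (borel B) R)
    (pi : probability (borel (B * B)%type) R) : Prop :=
  martingale_couplings mu nu pi /\
  forall pi', martingale_couplings mu nu pi' -> (cost c pi <= cost c pi')%E.

(* Main.v *)
Require Import Defs.
From HB Require Import structures.
From mathcomp Require Import all_boot all_order all_algebra.
From mathcomp Require Import all_classical all_reals all_analysis.
From mathcomp Require Import measurable_realfun lra.

Import Order.TTheory GRing.Theory Num.Theory.
Import numFieldNormedType.Exports.

Local Open Scope classical_set_scope.
Local Open Scope ring_scope.

Set Implicit Arguments.
Unset Strict Implicit.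
Unset Printing Implicit Defensive.

(** The upper bound holds because [pi_ n] competes for the value at [n]: its
    cost converges to that of [pit], as [c] is continuous and grows at most like
    the first moment, which converges along [pi_].

    The lower bound is a compactness argument. Along the indices where the value
    at [n] is close to the lower limit, choose nearly optimal martingale
    couplings [rho n]. Their marginals converge, so they are tight, and along an
    ultrafilter they have a narrow limit [pi]. It remains to see that [pi] is a
    martingale coupling of [mu] and [nu], and that its cost does not exceed the
    limit of the costs.

    Narrow convergence is used only through lower semicontinuity, [lsc_limit]:
    an eventual upper bound on the integrals of a nonnegative continuous
    function holds in the limit. This gives the statement on costs, as [c] is
    nonnegative. For a continuous function dominated by [growth_bound K], whose
    integrals converge because they depend on the marginals alone, the difference
    between the two is nonnegative and continuous, and the opposite inequality
    follows ([lsc_limit_integral_ge]).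

    The limit [pi] is constructed in [narrow_cluster_point]. Nested countable
    families of disjoint cells, of vanishing diameter, carry all the mass in the
    limit; the masses of the cells converge along the ultrafilter, and by tightness no mass is lost in
    the countable sums. The limit masses are the lengths of nested intervals
    that subdivide the unit interval. The centers of the cells named by the
    intervals around a point converge, uniformly in the point; the law of their
    limit, a random variable on the unit interval, is [pi]. At every level,
    [pi] and [rho n] are close to discrete laws on the same centers, and the
    masses of the latter converge to those of the former: this is the inequality
    for Lipschitz functions, and infimal convolutions extend it to continuous
    ones.

    The martingale property is a family of vector-valued Bochner integrals being
    zero. By the Hahn-Banach theorem ([norming_functional]) such an integral is
    zero as soon as its images under the functionals of norm at most one are
    ([functional_Bochner_integral0]), and these are integrals of real continuous
    functions of linear growth. *)

(** * Measurability for the Borel sigma-algebra *)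

Section borel_measurability.

Context (R : realType).
Implicit Types V W : normedModType R.

Lemma open_borel V (A : set V) :
  open A -> measurable (A : set (borel V)).
Proof. by move=> oA; apply: sub_sigma_algebra. Qed.

Lemma continuous_measurable_borel V W (f : V -> W) :
  continuous f -> @measurable_fun _ _ (borel V) (borel W) setT f.
Proof.
move=> /continuousP cf; apply: (measurability (@open W : set (set (borel W)))) => //.
move=> _ [A oA <-]; rewrite setTI; apply: open_borel; exact: cf.
Qed.

Lemma fst_measurable_borel V :
  @measurable_fun _ _ (borel (V * V)%type) (borel V) setT fst.
Proof.
by apply: (@continuous_measurable_borel (V * V)%type V) => z; exact: cvg_fst.
Qed.

Lemma snd_measurable_borel V :
  @measurable_fun _ _ (borel (V * V)%type) (borel V) setT snd.
Proof.
by apply: (@continuous_measurable_borel (V * V)%type V) => z; exact: cvg_snd.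
Qed.

Lemma continuous_measurable_real V (f : V -> R) :
  continuous f -> measurable_fun setT (f : borel V -> R).
Proof.
move=> /continuousP cf.
apply: (measurability _ (RGenOInfty.measurableE R)).
move=> _ [A [r ->] <-]; rewrite setTI.
by apply: open_borel; apply: cf; rewrite set_itvE.
Qed.

Lemma continuous_measurable_EFin V (f : V -> R) :
  continuous f -> measurable_fun setT (fun x : borel V => (f x)%:E).
Proof.
move=> cf; apply/measurable_EFinP; exact: continuous_measurable_real.
Qed.

End borel_measurability.

(** * Lower and upper limits *)

Section lower_limits.
Context (R : realType).
Implicit Types (u : nat -> \bar R) (a : \bar R).
Local Open Scope ereal_scope.

Lemma limn_einf_le u a : (forall n, u n <= a) -> limn_einf u <= a.
Proof.
move=> ua; rewrite limn_einf_lim; apply: lime_le; first exact: is_cvg_einfs.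
apply: nearW => n; apply: (le_trans _ (ua n)).
by apply: ereal_inf_lbound; exists n => /=.
Qed.

Lemma limn_einf_lt_frequently u a : limn_einf u < a ->
  forall N, exists2 n, (N <= n)%N & u n < a.
Proof.
move=> ua N; apply: contrapT => nua.
suff : a <= limn_einf u by rewrite leNgt ua.
rewrite limn_einf_lim; apply: lime_ge; first exact: is_cvg_einfs.
near=> m; apply: le_ereal_inf_tmp => _ [n /= mn <-].
rewrite leNgt; apply/negP => una; apply: nua; exists n => //.
by apply: leq_trans mn; near: m; exact: nbhs_infty_ge.
Unshelve. all: by end_near. Qed.

Lemma limn_esup_gt_frequently u a : a < limn_esup u ->
  forall N, exists2 n, (N <= n)%N & a < u n.
Proof.
move=> ua N; have [|n Nn nu] := @limn_einf_lt_frequently (-%E \o u) (- a) _ N.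
  by rewrite limn_einfN lteN2.
by exists n => //; rewrite -lteN2.
Qed.

End lower_limits.

(** * Infimal convolutions *)

Section infimal_convolution.
Context (R : realType) (V : normedModType R).
Implicit Types (h : V -> R) (m : nat) (x y : V).

Definition lipschitz_for (L : R) h := forall x y, h x <= h y + L * `|x - y|.

Definition lower_semicontinuous_at h x :=
  forall a, a < h x -> exists2 d, 0 < d & forall w, `|x - w| < d -> a < h w.

(** The largest minorant of [h] with Lipschitz constant [m]. *)
Definition infconv h m x := inf [set h w + m%:R * `|x - w| | w in setT].

Lemma lipschitz_for_continuous L h : 0 <= L -> lipschitz_for L h -> continuous h.
Proof.
move=> L0 hL x; apply/cvgrPdist_lt => e e0.
(* [L] may be zero, whence the division by [L + 1]. *)
have L1 : 0 < L + 1 by rewrite ltr_wpDl.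
near=> y.
have xy : `|x - y| < e / (L + 1).
  near: y; apply: (@cvgr_dist_lt _ _ _ _ _ id) => //; exact: divr_gt0.
have := hL x y; have := hL y x; rewrite (distrC y x) => h1 h2.
have h3 : L * `|x - y| < e.
  apply: (@le_lt_trans _ _ ((L + 1) * `|x - y|)).
    by rewrite ler_wpM2r// lerDl.
  by rewrite mulrC -ltr_pdivlMr.
by rewrite ltr_norml; apply/andP; split; lra.
Unshelve. all: by end_near. Qed.

Lemma continuous_lower_semicontinuous h x :
  {for x, continuous h} -> lower_semicontinuous_at h x.
Proof.
move=> ch a ahx.
have /nbhs_ballP[d d0 dP] : \forall w \near x, a < h w.
  exact: (cvgr_gt _ ch).
by exists d => // w xw; apply: dP; rewrite -ball_normE.
Qed.

Section nonnegative.
Context (h : V -> R) (h0 : forall x, 0 <= h x).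

Let infconv_has_inf m x : has_inf [set h w + m%:R * `|x - w| | w in setT].
Proof.
split; first by exists (h x + m%:R * `|x - x|), x.
by exists 0 => _ [w _ <-]; rewrite addr_ge0// mulr_ge0.
Qed.

Lemma infconv_ge0 m x : 0 <= infconv h m x.
Proof.
apply: lb_le_inf; first by have [] := infconv_has_inf m x.
by move=> _ [w _ <-]; rewrite addr_ge0// mulr_ge0.
Qed.

Lemma infconv_le m x : infconv h m x <= h x.
Proof.
apply: ge_inf; first by have [] := infconv_has_inf m x.
by exists x => //; rewrite subrr normr0 mulr0 addr0.
Qed.

Lemma infconv_lipschitz m : lipschitz_for m%:R (infconv h m).
Proof.
move=> x y; rewrite -lerBlDr; apply: lb_le_inf.
  by have [] := infconv_has_inf m y.
move=> _ [w _ <-]; rewrite lerBlDr.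
apply: (@le_trans _ _ (h w + m%:R * `|x - w|)).
  by apply: ge_inf; [have [] := infconv_has_inf m x|exists w].
rewrite -addrA lerD2l -mulrDr ler_wpM2l//.
by rewrite [leRHS]addrC ler_distD.
Qed.

(** Points [w] near [x] have [h w] almost as large as [h x], and for the
    other ones the penalty [m * `|x - w|] is eventually large. *)
Lemma infconv_cvg x : lower_semicontinuous_at h x ->
  infconv h m x @[m --> \oo] --> h x.
Proof.
move=> hx; apply/cvgrPdist_le => e e0.
have [|d d0 dP] := hx (h x - e); first by rewrite ltrBlDr ltrDl.
near=> m.
rewrite ger0_norm ?subr_ge0 ?infconv_le// lerBlDr -lerBlDl.
apply: lb_le_inf; first by have [] := infconv_has_inf m x.
move=> _ [w _ <-]; have [xw|xw] := ltP `|x - w| d.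
  by rewrite (le_trans (ltW (dP _ xw)))// lerDl mulr_ge0.
apply: (@le_trans _ _ (m%:R * d)); last first.
  by rewrite ler_wpDl// ler_wpM2l.
rewrite -ler_pdivrMr//; near: m; exact: nbhs_infty_ger.
Unshelve. all: by end_near. Qed.

End nonnegative.
End infimal_convolution.

(** * Narrow limits *)

Section lower_semicontinuity.
Context (R : realType) (V : normedModType R).
Local Open Scope ereal_scope.
Implicit Types P Q : probability (borel V) R.

(** The lower semicontinuity inequality of the portmanteau theorem. The bound [a]
    replaces a lower limit along the filter, which keeps the same definition
    usable for sequences, subsequences and ultrafilters. *)
Definition lsc_limit (F : set_system nat) (P_ : nat -> probability (borel V) R)
    P :=
  forall h : V -> R, (forall x, 0 <= h x)%R -> continuous h ->
  forall a : R, (\forall n \near F, \int[P_ n]_x (h x)%:E <= a%:E) ->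
  \int[P]_x (h x)%:E <= a%:E.

Lemma ge0_le_integral_borel P (f g : V -> R) :
  (forall x, 0 <= f x)%R -> continuous f -> continuous g ->
  (forall x, f x <= g x)%R ->
  \int[P]_x (f x)%:E <= \int[P]_x (g x)%:E.
Proof.
move=> f0 cf cg fg; apply: ge0_le_integral => //.
- by move=> x _; rewrite lee_fin.
- exact: continuous_measurable_EFin.
- exact: continuous_measurable_EFin.
- by move=> x _; rewrite lee_fin.
Qed.

Lemma integral_cst_borel P (r : R) : \int[P]_x r%:E = r%:E.
Proof.
rewrite integral_cst// -[RHS]mule1; congr (_ * _); exact: probability_setT.
Qed.

Lemma infconv_continuous (h : V -> R) m : (forall x, 0 <= h x)%R ->
  continuous (infconv h m).
Proof.
move=> h0; apply: lipschitz_for_continuous (infconv_lipschitz h0 m) => //.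
Qed.

(** Fatou's lemma along the infimal convolutions. *)
Lemma integral_le_infconv P (h : V -> R) (a : \bar R) :
  (forall x, 0 <= h x)%R -> (forall x, lower_semicontinuous_at h x) ->
  (forall m, \int[P]_x (infconv h m x)%:E <= a) -> \int[P]_x (h x)%:E <= a.
Proof.
move=> h0 hl ha.
have -> : \int[P]_x (h x)%:E
    = \int[P]_x limn_einf (fun m => (infconv h m x)%:E).
  apply: eq_integral => x _; apply/esym; apply: (fun c => (cvg_limn_einf_sup c).1).
  by apply: cvg_EFin; [exact: nearW|exact: infconv_cvg].
apply: (le_trans (fatou P measurableT _ _)).
- by move=> m; apply: continuous_measurable_EFin; exact: infconv_continuous.
- by move=> m x _; rewrite lee_fin infconv_ge0.
- exact: limn_einf_le.
Qed.

(** Lipschitz test functions suffice, because a nonnegative continuous function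
    is the limit from below of its infimal convolutions. *)
Lemma lsc_limit_lipschitz (F : set_system nat)
    (P_ : nat -> probability (borel V) R) P : Filter F ->
  (forall (L : R) (h : V -> R), (0 <= L)%R -> (forall x, 0 <= h x)%R ->
    lipschitz_for L h -> forall a : R,
    (\forall n \near F, \int[P_ n]_x (h x)%:E <= a%:E) ->
    \int[P]_x (h x)%:E <= a%:E) ->
  lsc_limit F P_ P.
Proof.
move=> FF HL h h0 ch a ha.
apply: integral_le_infconv => // [x|m].
  by apply: continuous_lower_semicontinuous; exact: ch.
apply: (HL m%:R) => //; first exact: infconv_ge0.
  exact: infconv_lipschitz.
apply: filterS ha => n; apply: le_trans.
apply: ge0_le_integral_borel => //; [exact: infconv_ge0| |exact: infconv_le].
exact: infconv_continuous.
Qed.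

End lower_semicontinuity.

(** * Couplings and the Wasserstein distance *)

Section couplings.
Context (R : realType) (V : normedModType R).
Local Open Scope ereal_scope.
Implicit Types (P Q : probability (borel V) R) (f g : V -> R).

Lemma coupling_integral_fst P Q gamma f : couplings P Q gamma ->
  continuous f -> (forall x, 0 <= f x)%R ->
  \int[gamma]_z (f z.1)%:E = \int[P]_x (f x)%:E.
Proof.
move=> gPQ cf f0.
have m1 := @fst_measurable_borel R V.
transitivity (\int[pushforward gamma (fst : borel (V * V)%type -> borel V)]_x (f x)%:E).
  rewrite ge0_integral_pushforward//; first exact: continuous_measurable_EFin.
  by move=> x _; rewrite lee_fin.
by apply: eq_measure_integral => A mA _; exact: (gPQ A mA).1.
Qed.

Lemma coupling_integral_snd P Q gamma f : couplings P Q gamma ->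
  continuous f -> (forall x, 0 <= f x)%R ->
  \int[gamma]_z (f z.2)%:E = \int[Q]_x (f x)%:E.
Proof.
move=> gPQ cf f0.
have m2 := @snd_measurable_borel R V.
transitivity (\int[pushforward gamma (snd : borel (V * V)%type -> borel V)]_x (f x)%:E).
  rewrite ge0_integral_pushforward//; first exact: continuous_measurable_EFin.
  by move=> x _; rewrite lee_fin.
by apply: eq_measure_integral => A mA _; exact: (gPQ A mA).2.
Qed.

Let cfst (f : V -> R) : continuous f ->
  continuous (fun z : (V * V)%type => f z.1).
Proof. by move=> cf z; apply: continuous_comp; [exact: cvg_fst|exact: cf]. Qed.

Let csnd (f : V -> R) : continuous f ->
  continuous (fun z : (V * V)%type => f z.2).
Proof. by move=> cf z; apply: continuous_comp; [exact: cvg_snd|exact: cf]. Qed.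

(** Integrating the pointwise inequality against the coupling separates the two
    marginals. *)
Lemma coupling_integral_fst_le P Q gamma f g (k : (V * V)%type -> R) :
  couplings P Q gamma ->
  continuous f -> (forall x, 0 <= f x)%R ->
  continuous g -> (forall x, 0 <= g x)%R ->
  continuous k -> (forall z, 0 <= k z)%R ->
  (forall x y, f x <= g y + k (x, y))%R ->
  \int[P]_x (f x)%:E <= \int[Q]_x (g x)%:E + \int[gamma]_z (k z)%:E.
Proof.
move=> gPQ cf f0 cg g0 ck k0 fgk.
rewrite -(coupling_integral_fst gPQ cf f0) -(coupling_integral_snd gPQ cg g0).
rewrite -ge0_integralD//; last 4 first.
  by move=> z _; rewrite lee_fin.
  by apply: continuous_measurable_EFin; exact: csnd.
  by move=> z _; rewrite lee_fin.
  exact: continuous_measurable_EFin.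
apply: (@ge0_le_integral_borel _ (V * V)%type gamma (fun z => f z.1)
  (fun z => g z.2 + k z)%R) => //.
- exact: cfst.
- by move=> z; apply: cvgD; [exact: csnd|exact: ck].
- by move=> [x y] /=.
Qed.

Lemma coupling_integral_snd_le P Q gamma f g (k : (V * V)%type -> R) :
  couplings P Q gamma ->
  continuous f -> (forall x, 0 <= f x)%R ->
  continuous g -> (forall x, 0 <= g x)%R ->
  continuous k -> (forall z, 0 <= k z)%R ->
  (forall x y, f y <= g x + k (x, y))%R ->
  \int[Q]_x (f x)%:E <= \int[P]_x (g x)%:E + \int[gamma]_z (k z)%:E.
Proof.
move=> gPQ cf f0 cg g0 ck k0 fgk.
rewrite -(coupling_integral_snd gPQ cf f0) -(coupling_integral_fst gPQ cg g0).
rewrite -ge0_integralD//; last 4 first.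
  by move=> z _; rewrite lee_fin.
  by apply: continuous_measurable_EFin; exact: cfst.
  by move=> z _; rewrite lee_fin.
  exact: continuous_measurable_EFin.
apply: (@ge0_le_integral_borel _ (V * V)%type gamma (fun z => f z.2)
  (fun z => g z.1 + k z)%R) => //.
- exact: csnd.
- by move=> z; apply: cvgD; [exact: cfst|exact: ck].
- by move=> [x y] /=.
Qed.

End couplings.

Section wasserstein.
Context (R : realType) (V : normedModType R) (N : V -> R).
Hypothesis N_cont : continuous N.
Hypothesis N_norm : forall x, `|x| <= N x.
Hypothesis N_opp : forall x, N (- x) = N x.
Local Open Scope ereal_scope.
Implicit Types P Q : probability (borel V) R.

Let N_ge0 x : (0 <= N x)%R. Proof. exact: le_trans (N_norm x). Qed.

Lemma continuous_sub_comp : continuous (fun z : (V * V)%type => N (z.1 - z.2)%R).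
Proof.
move=> z.
have cB : {for z, continuous (fun z : (V * V)%type => z.1 - z.2)%R}.
  by apply: cvgB; [exact: cvg_fst|exact: cvg_snd].
have := @continuous_comp _ _ _ (fun z : (V * V)%type => z.1 - z.2)%R N z cB.
by apply; exact: N_cont.
Qed.

(** Convergence in the Wasserstein distance, in a form that makes sense along
    any filter and needs no optimal coupling. *)
Definition coupling_near (F : set_system nat)
    (P_ : nat -> probability (borel V) R) P :=
  forall e : R, (0 < e)%R -> \forall n \near F, exists2 gamma,
    couplings (P_ n) P gamma & \int[gamma]_z (N (z.1 - z.2)%R)%:E <= e%:E.

Lemma wasserstein1_coupling_near (F : set_system nat)
    (P_ : nat -> probability (borel V) R) P : Filter F -> \oo `<=` F ->
  cvg_wasserstein1 N P_ P -> coupling_near F P_ P.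
Proof.
move=> FF ooF cP e e0; apply: ooF.
have : \forall n \near \oo, wasserstein1 N (P_ n) P < e%:E.
  exact: (cP _ (@nbhs_open_ereal_lt _ 0%R (fun=> e) e0)).
apply: filterS => n /ereal_inf_lt[_ [gamma g <-]] ge.
by exists gamma => //; exact: ltW.
Qed.

Lemma coupling_near_le_limit (F : set_system nat) {FF : Filter F}
    (P_ : nat -> probability (borel V) R) P (L : R) (h : V -> R) :
  coupling_near F P_ P -> (0 <= L)%R -> continuous h ->
  (forall x, 0 <= h x)%R -> (forall x y, h x <= h y + L * N (x - y))%R ->
  forall e : R, (0 < e)%R -> \forall n \near F,
    \int[P_ n]_x (h x)%:E <= \int[P]_x (h x)%:E + e%:E /\
    \int[P]_x (h x)%:E <= \int[P_ n]_x (h x)%:E + e%:E.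
Proof.
move=> cP L0 ch h0 hL e e0.
have L1 : (0 < L + 1)%R by rewrite ltr_wpDl.
have := cP (e / (L + 1))%R; rewrite divr_gt0// => /(_ isT); apply: filterS => n.
case=> gamma gP ge.
have kint : \int[gamma]_z (L * N (z.1 - z.2)%R)%:E <= e%:E.
  under eq_integral do rewrite EFinM.
  rewrite ge0_integralZl_EFin//; last first.
    by apply: continuous_measurable_EFin; exact: continuous_sub_comp.
    by move=> z _; rewrite lee_fin.
  apply: (@le_trans _ _ (L%:E * (e / (L + 1))%:E)).
    by apply: lee_wpmul2l => //; rewrite lee_fin.
  rewrite -EFinM lee_fin mulrA ler_pdivrMr// mulrC ler_wpM2l//; first exact: ltW.
  by rewrite lerDl.
have kc : continuous (fun z : (V * V)%type => L * N (z.1 - z.2)%R)%R.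
  by move=> z; apply: cvgMr; exact: continuous_sub_comp.
have k0 z : (0 <= L * N (z.1 - z.2)%R)%R by rewrite mulr_ge0.
split.
- apply: (le_trans (coupling_integral_fst_le gP ch h0 ch h0 kc k0 _)) => //.
  by rewrite leeD2l.
- apply: (le_trans (coupling_integral_snd_le gP ch h0 ch h0 kc k0 _)) => [x y|].
    by rewrite /= -N_opp opprB.
  by rewrite leeD2l.
Qed.

Lemma coupling_near_lsc_limit (F : set_system nat)
    (P_ : nat -> probability (borel V) R) P :
  ProperFilter F -> coupling_near F P_ P -> lsc_limit F P_ P.
Proof.
move=> FF cP; apply: lsc_limit_lipschitz => L h L0 h0 hL a ha.
apply/lee_addgt0Pr => e e0.
have hLN x y : (h x <= h y + L * N (x - y))%R.
  by rewrite (le_trans (hL x y))// lerD2l ler_wpM2l.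
have cPh := coupling_near_le_limit (FF := @filter_filter _ _ FF) cP L0
  (lipschitz_for_continuous L0 hL) h0 hLN e0.
have [n [na [_ nb]]] := filter_ex (filterI ha cPh).
by rewrite (le_trans nb)// leeD2r.
Qed.

End wasserstein.

(** * Integrals of functions with a converging bound *)

Section uniform_integrability.
Context (R : realType) (V : normedModType R).
Local Open Scope ereal_scope.

Lemma continuous_dominated_integrable (P : probability (borel V) R)
    (h G : V -> R) : continuous h -> continuous G ->
  (forall x, `|h x| <= G x)%R -> \int[P]_x (G x)%:E < +oo ->
  P.-integrable setT (EFin \o h).
Proof.
move=> ch cG hG Goo; apply/integrableP; split.
  exact: continuous_measurable_EFin.
apply: le_lt_trans Goo.
apply: (@ge0_le_integral_borel _ _ P (fun x => `|h x|)%R) => //.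
by move=> x; apply: cvg_norm; exact: ch.
Qed.

(** Lower semicontinuity, applied to the nonnegative function [G - h], bounds
    the integral of [h] from below, once the integrals of [G] along the filter do
    not exceed the one in the limit. *)
Lemma lsc_limit_integral_ge (F : set_system nat)
    (P_ : nat -> probability (borel V) R) (P : probability (borel V) R)
    (h G : V -> R) (b : R) : Filter F ->
  lsc_limit F P_ P -> continuous h -> continuous G ->
  (forall x, `|h x| <= G x)%R ->
  (forall n, \int[P_ n]_x (G x)%:E < +oo) -> \int[P]_x (G x)%:E < +oo ->
  (forall e : R, (0 < e)%R -> \forall n \near F,
    \int[P_ n]_x (G x)%:E <= \int[P]_x (G x)%:E + e%:E) ->
  (\forall n \near F, b%:E <= \int[P_ n]_x (h x)%:E) ->
  b%:E <= \int[P]_x (h x)%:E.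
Proof.
move=> FF lP ch cG hG GPn GP Glim hb.
have G0 x : (0 <= G x)%R by exact: le_trans (hG x).
have iG (Q : probability (borel V) R) : \int[Q]_x (G x)%:E < +oo -> Q.-integrable setT (EFin \o G).
  by apply: continuous_dominated_integrable => // x; rewrite ger0_norm.
have ih (Q : probability (borel V) R) : \int[Q]_x (G x)%:E < +oo -> Q.-integrable setT (EFin \o h).
  exact: continuous_dominated_integrable.
have GhE (Q : probability (borel V) R) : \int[Q]_x (G x)%:E < +oo ->
    \int[Q]_x (G x - h x)%:E = \int[Q]_x (G x)%:E - \int[Q]_x (h x)%:E.
  move=> Qoo; rewrite -integralB_EFin//; first exact: iG.
  exact: ih.
have fG (Q : probability (borel V) R) : \int[Q]_x (G x)%:E < +oo ->
  \int[Q]_x (G x)%:E = (fine (\int[Q]_x (G x)%:E))%:E.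
  by move=> Qoo; rewrite fineK//; apply: integrable_fin_num => //; exact: iG.
have fh (Q : probability (borel V) R) : \int[Q]_x (G x)%:E < +oo ->
  \int[Q]_x (h x)%:E = (fine (\int[Q]_x (h x)%:E))%:E.
  by move=> Qoo; rewrite fineK//; apply: integrable_fin_num => //; exact: ih.
apply/lee_addgt0Pr => e e0.
have : \int[P]_x (G x - h x)%:E <= (fine (\int[P]_x (G x)%:E) + e - b)%:E.
  apply: lP => [x|x|].
- by rewrite subr_ge0 (le_trans (ler_norm _)).
- by apply: cvgB; [exact: cG|exact: ch].
- apply: filterS2 hb (Glim e e0) => n.
  rewrite GhE// (fh _ (GPn n)) (fG _ (GPn n)) (fG _ GP) -EFinD -EFinB !lee_fin.
  by move=> bh Gh; rewrite lerB.
rewrite GhE// (fh _ GP) (fG _ GP) -EFinB -EFinD !lee_fin/=; lra.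
Qed.

Lemma lsc_limit_integral_eq0 (F : set_system nat)
    (P_ : nat -> probability (borel V) R) (P : probability (borel V) R)
    (h G : V -> R) : Filter F ->
  lsc_limit F P_ P -> continuous h -> continuous G ->
  (forall x, `|h x| <= G x)%R ->
  (forall n, \int[P_ n]_x (G x)%:E < +oo) -> \int[P]_x (G x)%:E < +oo ->
  (forall e : R, (0 < e)%R -> \forall n \near F,
    \int[P_ n]_x (G x)%:E <= \int[P]_x (G x)%:E + e%:E) ->
  (forall n, \int[P_ n]_x (h x)%:E = 0) ->
  \int[P]_x (h x)%:E = 0.
Proof.
move=> FF lP ch cG hG GPn GP Glim hn0.
have ih (Q : probability (borel V) R) : \int[Q]_x (G x)%:E < +oo -> Q.-integrable setT (EFin \o h).
  exact: continuous_dominated_integrable.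
have NE (Q : probability (borel V) R) : \int[Q]_x (G x)%:E < +oo ->
    \int[Q]_x (- h x)%:E = - \int[Q]_x (h x)%:E.
  move=> Qoo; rewrite -integralN//=; apply: integrable_add_def => //.
  exact: ih.
apply/eqP; rewrite eq_le; apply/andP; split.
- rewrite -leeN2 oppe0 -NE//.
  apply: (@lsc_limit_integral_ge F P_ P (fun x => - h x)%R G) => //.
  + by move=> x; apply: cvgN; exact: ch.
  + by move=> x; rewrite normrN.
  + by apply: nearW => n; rewrite NE// hn0 oppe0.
- apply: (@lsc_limit_integral_ge F P_ P h G) => //.
  by apply: nearW => n; rewrite hn0.
Qed.

End uniform_integrability.

(** * Trees of sets and nested intervals *)

Section trees.
Context (T : Type).
Implicit Types (C : seq nat -> set T) (s t : seq nat).

(** Nodes are finite sequences with the most recent choice at the head, so that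
    the children of [s] are the [i :: s]. *)
Definition tree_of_sets C := (forall i s, C (i :: s) `<=` C s) /\
  (forall s i j z, C (i :: s) z -> C (j :: s) z -> i = j).

Lemma tree_level_inj C s t z : tree_of_sets C -> size s = size t ->
  C s z -> C t z -> s = t.
Proof.
move=> [Csub Cinj]; elim: s t => [|i s IH] [|j t]//= [st] Cs Ct.
have est : s = t by apply: IH => //; [exact: Csub Cs|exact: Csub Ct].
by move: Ct; rewrite -est => Ct; rewrite (Cinj _ _ _ _ Cs Ct).
Qed.

(** The nodes of level [k], listed by the countability of [seq nat]; indices
    that are not the code of such a node get the default value. *)
Definition at_level {A} (a0 : A) k (f : seq nat -> A) (j : nat) : A :=
  if pickle_inv j is Some s then if size s == k then f s else a0 else a0.

Lemma trivIset_at_level C k : tree_of_sets C ->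
  trivIset setT (at_level set0 k C).
Proof.
move=> CT i j _ _ [z []]; rewrite /at_level.
case Ei : (pickle_inv i) => [s|//]; case: ifP => // /eqP sk Cs.
case Ej : (pickle_inv j) => [t|//]; case: ifP => // /eqP tk Ct.
have := @pickle_invK (seq nat) i; rewrite Ei /= => <-.
have := @pickle_invK (seq nat) j; rewrite Ej /= => <-.
by rewrite (tree_level_inj CT _ Cs Ct)// sk.
Qed.

Lemma bigcup_at_level C k :
  \bigcup_j at_level set0 k C j = \bigcup_(s in [set s | size s = k]) C s.
Proof.
rewrite predeqE => z; split => [[j _]|[s /= sk Cs]].
  rewrite /at_level; case: (pickle_inv j) => [s|//].
  by case: ifP => // /eqP sk Cs; exists s.
by exists (pickle s) => //; rewrite /at_level pickleK_inv sk eqxx.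
Qed.

End trees.

(** A mass function on the nodes that splits at every node into the masses of its
    children is realised by nested intervals, whose lengths are the masses. *)
Section nested_intervals.
Context (R : realType) (p : seq nat -> R).
Hypothesis p_ge0 : forall s, 0 <= p s.
Hypothesis p_children_le : forall s m, \sum_(0 <= i < m) p (i :: s) <= p s.
Hypothesis p_children_ge : forall s e, 0 < e ->
  exists m, p s <= \sum_(0 <= i < m) p (i :: s) + e.

Fixpoint left_end s : R :=
  if s is i :: s' then left_end s' + \sum_(0 <= j < i) p (j :: s') else 0.

Definition node_interval s : set R := `[left_end s, left_end s + p s[%classic.

Lemma measurable_node_interval s : measurable (node_interval s).
Proof. exact: measurable_itv. Qed.

Lemma lebesgue_node_interval s :
  lebesgue_measure (node_interval s : set R) = (p s)%:E.
Proof.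
rewrite lebesgue_measure_itv/= lte_fin ltrDl.
have := p_ge0 s; rewrite le_eqVlt => /predU1P[<-|->]; first by rewrite ltxx.
by rewrite -EFinB addrC addKr.
Qed.

Let sum_children_le s i j : (i <= j)%N ->
  \sum_(0 <= k < i) p (k :: s) <= \sum_(0 <= k < j) p (k :: s).
Proof.
by move=> ij; rewrite (big_cat_nat _ ij)//= lerDl sumr_ge0.
Qed.

Lemma node_interval_tree : tree_of_sets node_interval.
Proof.
have rightE i s : left_end (i :: s) + p (i :: s)
    = left_end s + \sum_(0 <= j < i.+1) p (j :: s).
  by rewrite /= big_nat_recr//= addrA.
split=> [i s u|s i j u].
  rewrite /node_interval /= !in_itv/= -/(left_end (i :: s)) rightE.
  move=> /andP[lu ur]; apply/andP; split.
    by rewrite (le_trans _ lu)//= lerDl sumr_ge0.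
  by rewrite (lt_le_trans ur)// lerD2l.
rewrite /node_interval /= !in_itv/= -/(left_end (i :: s)) -/(left_end (j :: s)).
rewrite !rightE => /andP[iu ui] /andP[ju uj].
have sum_le i' j' : (i' < j')%N ->
    left_end s + \sum_(0 <= k < i'.+1) p (k :: s)
      <= left_end s + \sum_(0 <= k < j') p (k :: s).
  by move=> ij; rewrite lerD2l; exact: sum_children_le.
apply/eqP; rewrite eqn_leq; apply/andP; split; rewrite leqNgt; apply/negP => ij.
  by have := lt_le_trans uj (le_trans (sum_le _ _ ij) iu); rewrite ltxx.
by have := lt_le_trans ui (le_trans (sum_le _ _ ij) ju); rewrite ltxx.
Qed.

Lemma node_interval_child s u : node_interval s u ->
  exists i, node_interval (i :: s) u.
Proof.
rewrite /node_interval /= in_itv/= => /andP[su us].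
(* With half the distance from [u] to the right end as error, finitely many
   children reach beyond [u]. *)
have [|m pm] := @p_children_ge s ((left_end s + p s - u) / 2).
  by rewrite divr_gt0// subr_gt0.
have exm : exists m, u < left_end s + \sum_(0 <= i < m) p (i :: s).
  by exists m; lra.
have := ex_minnP exm; case=> -[|i] ui imin.
  by move: ui; rewrite big_geq// addr0 ltNge su.
exists i; rewrite in_itv/=; apply/andP; split.
  by rewrite leNgt; apply/negP => /imin; rewrite ltnn.
by move: ui; rewrite big_nat_recr//= addrA.
Qed.

Lemma node_interval_level u k : node_interval [::] u ->
  exists2 s, size s = k & node_interval s u.
Proof.
move=> u0; elim: k => [|k [s sk su]]; first by exists [::].
by have [i iu] := node_interval_child su; exists (i :: s) => //=; rewrite sk.
Qed.

Definition branch u k : seq nat :=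
  xget [::] [set s | size s = k /\ node_interval s u].

Lemma branchP u k : node_interval [::] u ->
  size (branch u k) = k /\ node_interval (branch u k) u.
Proof.
move=> u0; have [s sk su] := node_interval_level k u0.
by rewrite /branch; case: xgetP => [t -> //|/(_ s)[]].
Qed.

Lemma branch_eq u s : node_interval [::] u -> node_interval s u ->
  branch u (size s) = s.
Proof.
move=> u0 su; have [bs bu] := branchP (size s) u0.
exact: (tree_level_inj node_interval_tree bs bu su).
Qed.

Lemma branchS u k : node_interval [::] u ->
  branch u k.+1 = head 0%N (branch u k.+1) :: branch u k.
Proof.
move=> u0; have [] := branchP k.+1 u0; case: (branch u k.+1) => [//|i s] /= [sk].
by move=> /node_interval_tree.1 su; rewrite -sk branch_eq.
Qed.

Lemma node_interval_gt0 s u : node_interval s u -> 0 < p s.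
Proof.
by rewrite /node_interval /= in_itv/= => /andP[su us]; have := le_lt_trans su us;
  rewrite ltrDl.
Qed.

End nested_intervals.

(** * Tight families have narrow limits along ultrafilters *)

Lemma ultrafilter_cvg_unit_interval (R : realType) (I : Type)
    (U : set_system I) (x : I -> R) :
  UltraFilter U -> (forall i, 0 <= x i <= 1) -> cvg (x i @[i --> U]).
Proof.
move=> UU x01.
have [|l [_ lcl]] := @segment_compact R 0 1 (x i @[i --> U]) _.
  by apply: nearW => i /=; rewrite in_itv/= x01.
apply/cvg_ex; exists l => A lA.
have [//|UnA] := in_ultra_setVsetC (x @^-1` A) UU.
have [|y [nAy Ay]] := lcl (~` A) A _ lA; last by [].
exact: UnA.
Qed.

Section narrow_compactness.
Context (R : realType) (E : normedModType R).
Hypothesis E_complete : forall u : nat -> E, cauchy (u @ \oo) -> cvg (u @ \oo).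
Context (U : set_system nat) (U_ultra : UltraFilter U).
Context (P_ : nat -> probability (borel E) R) (D : nat -> E).
(** In a complete space, covering all but little mass by finitely many balls of
    each radius amounts to tightness by compact sets. *)
Hypothesis P_tight : forall r e : R, 0 < r -> 0 < e -> exists M,
  \forall n \near U,
    (P_ n (~` \big[setU/set0]_(i < M) ball (D i) r) <= e%:E)%E.

Let rad k : R := k.+1%:R^-1.

Let rad_gt0 k : 0 < rad k. Proof. by rewrite invr_gt0. Qed.

Let rad_le k l : (k <= l)%N -> rad l <= rad k.
Proof. by move=> kl; rewrite lef_pV2 ?posrE// ler_nat. Qed.

Let rad_small (e : R) : 0 < e -> exists k, rad k < e.
Proof.
move=> e0; near \oo => k; exists k; near: k; exact: near_infty_natSinv_lt (PosNum e0).
Unshelve. all: by end_near. Qed.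

Let cell k : nat -> set E := seqDU (fun i => ball (D i) (rad k)).

(** The cells of level [k] are made from balls of radius [rad k]; a node [s]
    names one cell at each level below its size, the last one at its head. *)
Fixpoint cylinder (s : seq nat) : set E :=
  if s is i :: s' then cylinder s' `&` cell (size s') i else setT.

Let measurable_cell k i : measurable (cell k i : set (borel E)).
Proof.
apply: measurableD; first by apply: open_borel; exact: ball_open.
by apply: bigsetU_measurable => j _; apply: open_borel; exact: ball_open.
Qed.

Let measurable_cylinder s : measurable (cylinder s : set (borel E)).
Proof.
by elim: s => [|i s IH] /=; [exact: measurableT|exact: measurableI].
Qed.

Let cylinder_tree : tree_of_sets cylinder.
Proof.
split=> [i s z []//|s i j z [_ zi] [_ zj]].
apply: (trivIset_seqDU (fun i => ball (D i) (rad (size s)))) => //.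
by exists z.
Qed.

Let mass n s : R := fine (P_ n (cylinder s)).

Let massE n s : P_ n (cylinder s) = (mass n s)%:E.
Proof. by rewrite fineK// fin_num_measure. Qed.

Let mass01 n s : 0 <= mass n s <= 1.
Proof. by rewrite -!lee_fin -massE measure_ge0 probability_le1. Qed.

Let p s : R := lim (mass n s @[n --> U]).

Let mass_cvg s : mass n s @[n --> U] --> p s.
Proof. by apply: ultrafilter_cvg_unit_interval => n; exact: mass01. Qed.

Let p_ge0 s : 0 <= p s.
Proof.
by apply: (cvgr_to_ge (@mass_cvg s)); apply: nearW => n; case/andP: (mass01 n s).
Qed.

Let p_nil : p [::] = 1.
Proof.
apply/cvg_lim => //; rewrite (_ : mass^~ [::] = cst 1); first exact: cvg_cst.
by apply/funext => n; rewrite /mass /= probability_setT.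
Qed.

Let sum_mass n s m : (\sum_(0 <= i < m) mass n (i :: s))%:E
  = P_ n (cylinder s `&` \big[setU/set0]_(i < m) ball (D i) (rad (size s))).
Proof.
rewrite (bigsetU_seqDU (fun i => ball (D i) (rad (size s)))) big_distrr/=.
rewrite (measure_bigsetU (P_ n) (F := fun i => cylinder s `&` cell (size s) i)).
- by rewrite big_mkord -sumEFin; apply: eq_bigr => i _; rewrite -massE.
- by move=> i; exact: measurableI.
- exact: trivIset_setIl (trivIset_seqDU _).
Qed.

Let sum_mass_cvg s m :
  \sum_(0 <= i < m) mass n (i :: s) @[n --> U] --> \sum_(0 <= i < m) p (i :: s).
Proof. by apply: cvg_big => [|i _]; [exact: add_continuous|exact: mass_cvg]. Qed.

Let measurable_balls m r :
  measurable (\big[setU/set0]_(i < m) ball (D i) r : set (borel E)).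
Proof.
by apply: bigsetU_measurable => i _; apply: open_borel; exact: ball_open.
Qed.

Let p_children_le s m : \sum_(0 <= i < m) p (i :: s) <= p s.
Proof.
apply: ler_cvg_to (@sum_mass_cvg s m) (@mass_cvg s) _; apply: nearW => n.
rewrite -lee_fin sum_mass -massE; apply: le_measure; rewrite ?inE//.
exact: measurableI.
Qed.

(** Tightness enters here: the mass of the infinitely many children after the
    first [m] is uniformly small, so it does not escape in the limit. *)
Let p_children_ge s e : 0 < e -> exists m, p s <= \sum_(0 <= i < m) p (i :: s) + e.
Proof.
move=> e0; have [m me] := P_tight (rad_gt0 (size s)) e0; exists m.
apply: (ler_cvg_to (@mass_cvg s) (cvgD (@sum_mass_cvg s m) (cvg_cst e))).
apply: filterS me => n ne; rewrite -lee_fin EFinD sum_mass -massE.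
apply: (le_trans _ (leeD2l _ ne)).
rewrite -measureU//; last 3 first.
  exact: measurableI.
  exact: measurableC.
  by rewrite predeqE => z; split => // -[[_ zB] /(_ zB)].
apply: le_measure; rewrite ?inE//.
  by apply: measurableU; [exact: measurableI|exact: measurableC].
move=> z zs; have [zB|zB] := pselect ((\big[setU/set0]_(i < m) ball (D i) (rad (size s))) z).
  by left.
by right.
Qed.

Let J := node_interval p.
Let J_tree : tree_of_sets J := node_interval_tree p_ge0 p_children_le.

Let J_nil : J [::] = `[0, 1[%classic.
Proof. by rewrite /J /node_interval /= add0r p_nil. Qed.

Let center s : E := D (head 0%N s).

Let cylinder_center s z : (0 < size s)%N -> cylinder s z ->
  `|center s - z| < rad (size s).-1.
Proof.
by case: s => //= i s _ [_ [zi _]]; move: zi; rewrite -ball_normE.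
Qed.

(** A node whose limit mass is positive has positive mass for some [n]. *)
Let cylinder_ex s u : J s u -> cylinder s !=set0.
Proof.
move=> /node_interval_gt0 ps; apply: contrapT => /set0P/negP/negPn/eqP s0.
have : p s = 0.
  apply/cvg_lim => //; rewrite (_ : mass^~ s = cst 0); first exact: cvg_cst.
  by apply/funext => n; rewrite /mass s0 measure0.
by move=> ps0; move: ps; rewrite ps0 ltxx.
Qed.

Let X_ u k : E := center (branch p u k.+1).

Let branch_cylinder u k l : J [::] u -> (k <= l)%N ->
  cylinder (branch p u l) `<=` cylinder (branch p u k).
Proof.
move=> u0; elim: l => [|l IH]; first by rewrite leqn0 => /eqP ->.
rewrite leq_eqVlt => /predU1P[->//|]; rewrite ltnS => /IH; apply: subset_trans.
rewrite branchS//; exact: cylinder_tree.1.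
Qed.

Let X_dist u k l : J [::] u -> (k <= l)%N -> `|X_ u k - X_ u l| <= 2 * rad k.
Proof.
move=> u0 kl; have [sl ul] := branchP p_children_ge l.+1 u0.
have [sk _] := branchP p_children_ge k.+1 u0.
have [z zl] := cylinder_ex ul.
have zk : cylinder (branch p u k.+1) z by exact: branch_cylinder zl.
have dk := cylinder_center _ zk; have dl := cylinder_center _ zl.
rewrite sk/= in dk; rewrite sl/= in dl.
rewrite (le_trans (ler_distD z _ _))// mulr_natl mulr2n lerD//.
  exact/ltW/dk.
by rewrite distrC (le_trans (ltW (dl _)))// rad_le.
Qed.

(** The nested intervals name nested nonempty cells, so the centers met along a
    branch form a Cauchy sequence, with a rate that does not depend on [u]. *)
Let X u : E := lim (X_ u k @[k --> \oo]).

Let X_cvg u : J [::] u -> X_ u k @[k --> \oo] --> X u.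
Proof.
move=> u0; apply: E_complete; apply: cauchy_exP => e e0.
have [|k ke] := @rad_small (e / 2); first by rewrite divr_gt0.
exists (X_ u k); exists k => // l /= kl; rewrite -ball_normE /=.
by rewrite (le_lt_trans (X_dist u0 kl))// -ltr_pdivlMl// mulrC.
Qed.

Let X_center s u : (0 < size s)%N -> J s u ->
  `|X u - center s| <= 2 * rad (size s).-1.
Proof.
move=> s0 su.
have u0 : J [::] u.
  by elim: s su {s0} => // i s IH /(J_tree.1 i); exact: IH.
have -> : center s = X_ u (size s).-1.
  by rewrite /X_ prednK// (branch_eq p_ge0 p_children_le p_children_ge).
apply: (@cvgr_to_le _ \oo _ _ (fun l => `|X_ u l - X_ u (size s).-1|)).
  by apply: cvg_norm; apply: cvgB; [exact: X_cvg|exact: cvg_cst].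
by exists (size s).-1 => // l /= sl; rewrite distrC X_dist.
Qed.

Let limit_node (G : set E) s : Prop := (0 < size s)%N /\
  forall z, `|z - center s| <= 2 * rad (size s).-1 -> G z.

(** The uniform rate makes preimages of open sets countable unions of intervals. *)
Let preimage_X G : open G ->
  `[0, 1[%classic `&` X @^-1` G = \bigcup_s [set u | limit_node G s /\ J s u].
Proof.
move=> oG; rewrite -J_nil predeqE => u; split => [[u0 /= XG]|[s _ [[s0 sG] su]]].
  have [e /= e0 eG] : exists2 e, 0 < e & forall z, `|X u - z| < e -> G z.
    have /nbhs_ballP[e e0 eG] := open_nbhs_nbhs (conj oG XG).
    by exists e => // z ze; apply: eG; rewrite -ball_normE.
  have [|k ke] := @rad_small (e / 4); first by rewrite divr_gt0.
  have [bk bu] := branchP p_children_ge k.+1 u0.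
  exists (branch p u k.+1) => //; split => //; split; first by rewrite bk.
  move=> z; rewrite bk/= => zk; apply: eG.
  rewrite (le_lt_trans (ler_distD (center (branch p u k.+1)) _ _))//.
  have := X_center _ bu; rewrite bk/= => /(_ isT) Xk.
  have := lerD Xk zk; rewrite (distrC z) => /le_lt_trans; apply; lra.
split; last by apply: sG; exact: X_center.
by elim: s su {s0 sG} => // i s IH /(J_tree.1 i); exact: IH.
Qed.

Let X' u : E := if u \in `[0, 1[%classic then X u else 0.

Let X'_measurable :
  @measurable_fun _ _ (measurableTypeR R) (borel E) setT X'.
Proof.
apply: (measurability (@open E : set (set (borel E)))) => //.
move=> _ [G oG <-]; rewrite setTI.
have -> : X' @^-1` G = (`[0, 1[%classic `&` X @^-1` G) `|`
    (~` `[0, 1[%classic `&` [set _ | G 0]).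
  rewrite predeqE => u; rewrite /X' /=; case: ifPn => [|]; rewrite ?inE ?notin_setE.
    by move=> u0; split; [left|case=> -[]].
  by move=> u0; split; [right|case=> -[]].
apply: measurableU.
  rewrite preimage_X//; apply: countable_bigcupT_measurable => [|s]; first exact: countableP.
  have [Gs|Gs] := pselect (limit_node G s).
    rewrite (_ : [set _ | _] = J s); first exact: measurable_node_interval.
    by rewrite predeqE => u; split => [[]//|].
  rewrite (_ : [set _ | _] = set0)//.
  by rewrite predeqE => u; split => [[]//|].
apply: measurableI; first by apply: measurableC; exact: measurable_itv.
have [G0|G0] := pselect (G 0).
  by rewrite (_ : [set _ | _] = setT)// predeqE.
by rewrite (_ : [set _ | _] = set0)// predeqE.
Qed.

Let limit_law : probability (borel E) R :=
  distribution (uniform_prob (@ltr01 R)) (mfun_Sub (mem_set X'_measurable)).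

(** On a cell, the value of [h] at the center exceeds the other values by at most
    [L] times the radius. *)
Let node_mass_le (L : R) (h : E -> R) n k j :
  0 <= L -> (forall x, 0 <= h x) -> lipschitz_for L h ->
  ((at_level 0 k.+1 (fun s => h (center s) * mass n s) j)%:E <=
   \int[P_ n]_(z in at_level set0 k.+1 cylinder j) (h z + L * rad k)%:E)%E.
Proof.
move=> L0 h0 hL; have h_cont := lipschitz_for_continuous L0 hL.
have hr0 z : 0 <= h z + L * rad k by rewrite addr_ge0// mulr_ge0// ltW.
rewrite /at_level; case: (pickle_inv j) => [s|]; last first.
  by apply: integral_ge0 => z _; rewrite lee_fin.
case: ifP => [/eqP sk|_]; last by apply: integral_ge0 => z _; rewrite lee_fin.
rewrite EFinM -massE -integral_cst//; apply: ge0_le_integral => //.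
- by move=> z _; rewrite lee_fin.
- apply: measurable_funTS; apply: continuous_measurable_EFin => z.
  by apply: cvgD; [exact: h_cont|exact: cvg_cst].
- move=> z zs; rewrite lee_fin (le_trans (hL (center s) z))// lerD2l.
  rewrite ler_wpM2l// ltW//.
  by have := cylinder_center _ zs; rewrite sk; apply.
Qed.

(** Finite sums over cells pass to the limit along the ultrafilter. *)
Let level_sum_le (L : R) (h : E -> R) k (a : R) m :
  0 <= L -> (forall x, 0 <= h x) -> lipschitz_for L h ->
  (\forall n \near U, (\int[P_ n]_z (h z)%:E <= a%:E)%E) ->
  \sum_(0 <= j < m) at_level 0 k.+1 (fun s => h (center s) * p s) j
    <= a + L * rad k.
Proof.
move=> L0 h0 hL ha; have h_cont := lipschitz_for_continuous L0 hL.
have cvgj j : at_level 0 k.+1 (fun s => h (center s) * mass n s) j @[n --> U]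
    --> at_level 0 k.+1 (fun s => h (center s) * p s) j.
  rewrite /at_level; case: (pickle_inv j) => [s|]; last exact: cvg_cst.
  by case: ifP => _; [apply: cvgMr; exact: mass_cvg|exact: cvg_cst].
have sum_cvg : \sum_(0 <= j < m)
      at_level 0 k.+1 (fun s => h (center s) * mass n s) j @[n --> U]
    --> \sum_(0 <= j < m) at_level 0 k.+1 (fun s => h (center s) * p s) j.
  by apply: cvg_big => [|j _]; [exact: add_continuous|exact: cvgj].
apply: (cvgr_to_le sum_cvg); apply: filterS ha => n ha.
have hc : continuous (fun z => h z + L * rad k).
  by move=> z; apply: cvgD; [exact: h_cont|exact: cvg_cst].
have hr0 z : 0 <= h z + L * rad k by rewrite addr_ge0// mulr_ge0// ltW.
have mC j : measurable (at_level set0 k.+1 cylinder j : set (borel E)).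
  rewrite /at_level; case: (pickle_inv j) => [s|]; last exact: measurable0.
  by case: ifP => _ //; exact: measurable0.
rewrite -lee_fin -sumEFin.
apply: (le_trans (lee_sum _ (fun j _ => node_mass_le n k j L0 h0 hL))).
rewrite -(ge0_integral_bigsetU (P_ n) mC (iota_uniq _ _)); last 3 first.
- by apply: (@sub_trivIset _ _ _ setT) => //; exact: trivIset_at_level.
- by apply: measurable_funTS; exact: continuous_measurable_EFin.
- by move=> z _; rewrite lee_fin.
apply: (@le_trans _ _ (\int[P_ n]_z (h z + L * rad k)%:E)%E).
  apply: ge0_subset_integral => //.
  - by apply: bigsetU_measurable => j _; exact: mC.
  - exact: continuous_measurable_EFin.
  - by move=> z _; rewrite lee_fin.
under eq_integral do rewrite EFinD.
rewrite ge0_integralD//; last 3 first.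
- by move=> z _; rewrite lee_fin.
- exact: continuous_measurable_EFin.
- by move=> z _; rewrite lee_fin mulr_ge0// ltW.
by rewrite integral_cst_borel EFinD leeD2r.
Qed.

Let limit_law_integral (h : E -> R) k :
  (forall x, 0 <= h x) -> continuous h ->
  (\int[limit_law]_z (h z)%:E =
   \sum_(0 <= j <oo)
     \int[lebesgue_measure]_(u in at_level set0 k.+1 J j) (h (X' u))%:E)%E.
Proof.
move=> h0 hc.
have mhX : measurable_fun setT (fun u : measurableTypeR R => (h (X' u))%:E).
  exact: (measurableT_comp (continuous_measurable_EFin hc) X'_measurable).
rewrite ge0_integral_distribution; last 2 first.
- exact: continuous_measurable_EFin.
- by move=> z; rewrite lee_fin.
rewrite integral_uniform//; last by move=> u; rewrite lee_fin.
rewrite subr0 invr1 mul1e.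
rewrite -integral_itv_bndo_bndc; last exact: measurable_funTS.
have -> : `[0%R, 1%R[%classic = \bigcup_j at_level set0 k.+1 J j.
  rewrite bigcup_at_level -J_nil predeqE => u; split => [u0|[s /= _ su]].
    by have [s sk su] := node_interval_level p_children_ge k.+1 u0; exists s.
  by elim: s su => // i s IH /(J_tree.1 i); exact: IH.
rewrite ge0_integral_bigcup//.
- move=> j; rewrite /at_level; case: (pickle_inv j) => [s|//].
  by case: ifP => // _; exact: measurable_node_interval.
- exact: measurable_funTS.
- by move=> u _; rewrite lee_fin.
- exact: trivIset_at_level J_tree.
Qed.

(** The law of the limit of the centers is within [2 * rad k] of its
    discretisation at level [k], and [P_ n] is within [rad k] of the
    discretisation with the masses [mass n]. *)
Lemma narrow_cluster_point : exists P, lsc_limit U P_ P.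
Proof.
exists limit_law; apply: lsc_limit_lipschitz => L h L0 h0 hL a ha.
have hc : continuous h by exact: lipschitz_for_continuous hL.
(* One radius comes from the cells under [P_ n], two from the distance of [X]
   to the centers. *)
suff main k : (\int[limit_law]_x (h x)%:E <= (a + 3 * L * rad k)%:E)%E.
  apply/lee_addgt0Pr => e e0.
  have [|k ke] := @rad_small (e / (3 * L + 1)).
    by rewrite divr_gt0// ltr_wpDl// mulr_ge0.
  rewrite (le_trans (main k))// EFinD leeD2l// lee_fin.
  rewrite ltr_pdivlMr in ke; last by rewrite ltr_wpDl// mulr_ge0.
  rewrite (le_trans _ (ltW ke))// mulrC ler_wpM2l ?lerDl//; exact: ltW.
rewrite (limit_law_integral k)//.
(* Adding the error to [h] from the start avoids a separate bound on the total
   mass of the nodes of a level. *)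
pose g x := h x + 2 * L * rad k.
have g0 x : 0 <= g x by rewrite addr_ge0// !mulr_ge0// ltW.
have gL : lipschitz_for L g.
  by move=> x y; rewrite /g addrAC lerD2r.
have ga : \forall n \near U,
    (\int[P_ n]_z (g z)%:E <= (a + 2 * L * rad k)%:E)%E.
  apply: filterS ha => n ha.
  under eq_integral do rewrite EFinD.
  rewrite ge0_integralD//; last 3 first.
  - by move=> z _; rewrite lee_fin.
  - exact: continuous_measurable_EFin.
  - by move=> z _; rewrite lee_fin !mulr_ge0// ltW.
  by rewrite integral_cst_borel EFinD leeD2r.
apply: lime_le.
  by apply: is_cvg_nneseries => j _ _; apply: integral_ge0 => u _; rewrite lee_fin.
apply: nearW => m.
apply: (@le_trans _ _ (\sum_(0 <= j < m)
    (at_level 0 k.+1 (fun s => g (center s) * p s) j)%:E)%E).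
  apply: lee_sum => j _; rewrite /at_level.
  case: (pickle_inv j) => [s|]; last by rewrite integral_set0.
  case: ifP => [/eqP sk|_]; last by rewrite integral_set0.
  rewrite EFinM -(lebesgue_node_interval p_ge0 s) -integral_cst; last first.
    exact: measurable_node_interval.
  apply: ge0_le_integral => //.
  - exact: measurable_node_interval.
  - by move=> u _; rewrite lee_fin.
  - apply: measurable_funTS.
    exact: (measurableT_comp (continuous_measurable_EFin hc) X'_measurable).
  - move=> u su; rewrite lee_fin /X'.
    have : u \in `[0, 1[%classic.
      by rewrite inE -J_nil; elim: s su {sk} => // i s IH /(J_tree.1 i); exact: IH.
    move=> ->; rewrite (le_trans (hL _ (center s)))// lerD2l -mulrA mulrCA.
    by rewrite ler_wpM2l//; have := X_center _ su; rewrite sk; apply.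
rewrite sumEFin lee_fin.
rewrite (le_trans (level_sum_le k m L0 g0 gL ga))//; lra.
Qed.

End narrow_compactness.

(** * Tightness of couplings *)

Lemma separable_dense_sequence (R : realType) (B : normedModType R) :
  separable_space B ->
  exists b : nat -> B, forall x e, 0 < e -> exists i, `|x - b i| < e.
Proof.
move=> [D [/countable_injP[f finj] Ddense]].
exists (fun i => xget 0 [set x | D x /\ f x = i]) => x e e0.
have [||y [xy Dy]] := Ddense (ball x e).
- by exists x; exact: ballxx.
- exact: ball_open.
exists (f y); case: xgetP => [z _ [Dz fzy]|/(_ y)[]//].
by rewrite (finj z y)// ?inE//; move: xy; rewrite -ball_normE.
Qed.

Section tightness.
Context (R : realType) (B : normedModType R) (b : nat -> B).
Hypothesis b_dense : forall x e, 0 < e -> exists i, `|x - b i| < e.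
Local Open Scope ereal_scope.

Definition balls r M : set B := \big[setU/set0]_(i < M) ball (b i) r.

Lemma ballsE r M : balls r M = \bigcup_(i in `I_M) ball (b i) r.
Proof. by rewrite /balls -(bigcup_mkord _ (fun i => ball (b i) r)). Qed.

Lemma measurable_balls r M : measurable (balls r M : set (borel B)).
Proof.
by apply: bigsetU_measurable => i _; apply: open_borel; exact: ball_open.
Qed.

(** The balls around a dense sequence exhaust the space. *)
Lemma probability_tight (P : probability (borel B) R) (r e : R) :
  (0 < r)%R -> (0 < e)%R -> exists M, P (~` balls r M) <= e%:E.
Proof.
move=> r0 e0.
have cover : \bigcup_M balls r M = [set: B].
  rewrite predeqE => x; split => // _; have [i xi] := b_dense x r0.
  exists i.+1 => //; rewrite ballsE; exists i => //=.
  by rewrite -ball_normE /= distrC.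
have : P (balls r M) @[M --> \oo] --> 1.
  have -> : 1 = P (\bigcup_M balls r M).
    by rewrite cover; apply/esym; exact: probability_setT.
  apply: nondecreasing_cvg_mu.
  - by move=> M; exact: measurable_balls.
  - by rewrite cover.
  - move=> M N MN; apply/subsetPset; rewrite !ballsE => x [i /= iM xi].
    by exists i => //=; exact: leq_trans MN.
move=> /(_ _ (@nbhs_open_ereal_gt _ 1%R (fun=> 1 - e)%R _)).
case=> [|M _ /(_ M (leqnn M))/= PM]; first by rewrite ltrBlDr ltrDl.
exists M; rewrite probability_setC//; last exact: measurable_balls.
have := fin_num_measure P _ (measurable_balls r M); move: PM.
case: (P (balls r M)) => [q| |] PM // fq; last by rewrite leNye.
have {}PM : (1 - e < q)%R := PM.
by rewrite -EFinB lee_fin; lra.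
Qed.

(** Markov's inequality for a coupling that moves little mass far transfers
    tightness from the limit to the approximating laws. *)
Lemma coupling_near_tight (F : set_system nat)
    (P_ : nat -> probability (borel B) R) P :
  Filter F -> coupling_near (fun x => `|x|)%R F P_ P ->
  forall r e : R, (0 < r)%R -> (0 < e)%R -> exists M,
    \forall n \near F, P_ n (~` balls r M) <= e%:E.
Proof.
move=> FF cP r e r0 e0.
have r20 : (0 < r / 2)%R by rewrite divr_gt0.
have e20 : (0 < e / 2)%R by rewrite divr_gt0.
have [M PM] := probability_tight P r20 e20; exists M.
apply: filterS (cP (r / 2 * (e / 2))%R (mulr_gt0 r20 e20)) => n [gamma gP ge].
pose far : set (borel (B * B)%type) := [set z | (r / 2 <= `|z.1 - z.2|)%R].
have cN : continuous (fun z : (B * B)%type => `|z.1 - z.2|)%R.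
  by move=> z; apply: cvg_norm; apply: cvgB; [exact: cvg_fst|exact: cvg_snd].
have mfar : measurable far.
  rewrite -[far]setTI.
  have := continuous_measurable_real cN measurableT (measurable_itv `[(r / 2)%R, +oo[).
  congr (measurable (_ `&` _)); rewrite /far predeqE => z /=.
  by rewrite in_itv/= andbT.
have mb s : measurable (~` balls s M : set (borel B)).
  by apply: measurableC; exact: measurable_balls.
have gfar : gamma far <= (e / 2)%:E.
  rewrite -(@lee_pmul2l _ (r / 2)%:E)// ?lte_fin// -integral_cst//.
  apply: le_trans ge; apply: (@le_trans _ _ (\int[gamma]_(z in far) (`|z.1 - z.2|)%:E)).
    apply: ge0_le_integral => //.
    - by move=> z _; rewrite lee_fin ltW.
    - by apply: measurable_funTS; exact: continuous_measurable_EFin.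
  apply: ge0_subset_integral => //; first exact: continuous_measurable_EFin.
rewrite -(gP _ (mb r)).1.
have mfst : measurable (fst @^-1` (~` balls r M) : set (borel (B * B)%type)).
  by have := @fst_measurable_borel R B measurableT _ (mb r); rewrite setTI.
have msnd : measurable (snd @^-1` (~` balls (r / 2) M) : set (borel (B * B)%type)).
  by have := @snd_measurable_borel R B measurableT _ (mb (r / 2)%R); rewrite setTI.
apply: (@le_trans _ _ (gamma (snd @^-1` (~` balls (r / 2) M) `|` far))).
  apply: le_measure; rewrite ?inE//; first exact: measurableU.
  move=> [x y] /= xb; have [xy|xy] := leP (r / 2)%R `|x - y|%R; [by right|left => yb].
  apply: xb; move: yb; rewrite !ballsE => -[i /= iM].
  rewrite -ball_normE /= => iy; exists i => //=.
  rewrite (le_lt_trans (ler_distD y _ _))//.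
  by rewrite [ltRHS](splitr r) ltrD// distrC.
apply: (le_trans (measureU2 _ _ _)) => //.
rewrite (splitr e) EFinD leeD//.
by apply: le_trans PM; rewrite -(gP _ (mb (r / 2)%R)).2.
Qed.

Definition pair_sequence j : (B * B)%type :=
  if (pickle_inv j : option (nat * nat)) is Some ij then (b ij.1, b ij.2) else 0%R.

(** A pair outside the balls around all pairs of centers has one component
    outside the balls around the centers. *)
Lemma couplings_tight (F : set_system nat) (P_ Q_ : nat -> probability (borel B) R)
    (pi_ : nat -> probability (borel (B * B)%type) R) :
  Filter F -> (forall n, couplings (P_ n) (Q_ n) (pi_ n)) ->
  (forall r e : R, (0 < r)%R -> (0 < e)%R -> exists M,
    \forall n \near F, P_ n (~` balls r M) <= e%:E) ->
  (forall r e : R, (0 < r)%R -> (0 < e)%R -> exists M,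
    \forall n \near F, Q_ n (~` balls r M) <= e%:E) ->
  forall r e : R, (0 < r)%R -> (0 < e)%R -> exists M,
    \forall n \near F,
      pi_ n (~` \big[setU/set0]_(j < M) ball (pair_sequence j) r) <= e%:E.
Proof.
move=> FF pc Pt Qt r e r0 e0.
have e20 : (0 < e / 2)%R by rewrite divr_gt0.
have [M1 PM1] := Pt r _ r0 e20; have [M2 QM2] := Qt r _ r0 e20.
pose M := (\max_(ij : 'I_M1 * 'I_M2) (pickle (val ij.1, val ij.2)).+1)%N.
exists M; apply: filterS2 PM1 QM2 => n PM1 QM2.
have mb K : measurable (~` balls r K : set (borel B)).
  by apply: measurableC; exact: measurable_balls.
have mfst : measurable (fst @^-1` (~` balls r M1) : set (borel (B * B)%type)).
  by have := @fst_measurable_borel R B measurableT _ (mb M1); rewrite setTI.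
have msnd : measurable (snd @^-1` (~` balls r M2) : set (borel (B * B)%type)).
  by have := @snd_measurable_borel R B measurableT _ (mb M2); rewrite setTI.
apply: (@le_trans _ _ (pi_ n (fst @^-1` (~` balls r M1) `|` snd @^-1` (~` balls r M2)))).
  apply: le_measure; rewrite ?inE//; last 2 first.
  - exact: measurableU.
  - move=> [x y] /= xyD; apply: contrapT => /not_orP[/contrapT xb /contrapT yb].
    apply: xyD; move: xb yb; rewrite !ballsE.
    rewrite -(bigcup_mkord _ (fun j => ball (pair_sequence j) r)).
    move=> [i /= iM1 xi] [j /= jM2 yj]; exists (pickle (i, j)) => /=; last first.
      by rewrite /pair_sequence pickleK_inv.
    exact: (@leq_bigmax_cond _ _ (fun ij : 'I_M1 * 'I_M2 => (pickle (val ij.1, val ij.2)).+1)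
      (Ordinal iM1, Ordinal jM2)).
  - apply: measurableC; apply: bigsetU_measurable => j _; apply: open_borel.
    exact: (@ball_open _ (B * B)%type).
apply: (le_trans (measureU2 _ _ _)) => //.
rewrite (splitr e) EFinD leeD//.
  by apply: le_trans PM1; rewrite -(pc n _ (mb M1)).1.
by apply: le_trans QM2; rewrite -(pc n _ (mb M2)).2.
Qed.

End tightness.

(** * Lipschitz functions determine a probability *)

Section lipschitz_determine.
Context (R : realType) (V : normedModType R).
Local Open Scope ereal_scope.

Lemma indic_lower_semicontinuous (G : set V) x : open G ->
  lower_semicontinuous_at (\1_G : V -> R) x.
Proof.
move=> oG a; have [xG|xG] := pselect (G x).
  rewrite indicE mem_set//= => a1.
  have /nbhs_ballP[d d0 dG] := open_nbhs_nbhs (conj oG xG).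
  exists d => // w xw; rewrite indicE mem_set//.
  by apply: dG; rewrite -ball_normE.
rewrite indicE memNset//= => a0; exists 1%R => // w _.
by rewrite (lt_le_trans a0).
Qed.

(** An inequality between the integrals of all Lipschitz functions with values
    in the unit interval is an equality, as [1 - h] is one of them; indicators
    of open sets are limits of such functions. *)
Lemma probability_eq_lipschitz (P Q : probability (borel V) R) :
  (forall (L : R) (h : V -> R), (0 <= L)%R -> (forall x, 0 <= h x <= 1)%R ->
    lipschitz_for L h -> \int[P]_x (h x)%:E <= \int[Q]_x (h x)%:E) ->
  forall A : set (borel V), measurable A -> P A = Q A.
Proof.
move=> PQ.
have PQeq (L : R) (h : V -> R) : (0 <= L)%R -> (forall x, 0 <= h x <= 1)%R ->
    lipschitz_for L h -> \int[P]_x (h x)%:E = \int[Q]_x (h x)%:E.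
  move=> L0 h01 hL.
  have hc := lipschitz_for_continuous L0 hL.
  have h0 x : (0 <= h x)%R by case/andP: (h01 x).
  have h1 x : (0 <= 1 - h x)%R by rewrite subr_ge0; case/andP: (h01 x).
  have h'c : continuous (fun x => 1 - h x)%R.
    by move=> x; apply: cvgB; [exact: cvg_cst|exact: hc].
  have sum1 (S : probability (borel V) R) :
      \int[S]_x (h x)%:E + \int[S]_x (1 - h x)%:E = 1.
    rewrite -ge0_integralD//; last 4 first.
    - by move=> x _; rewrite lee_fin.
    - exact: continuous_measurable_EFin.
    - by move=> x _; rewrite lee_fin.
    - exact: continuous_measurable_EFin.
    under eq_integral do rewrite -EFinD subrKC.
    exact: integral_cst_borel.
  have fin (S : probability (borel V) R) (g : V -> R) :
      (forall x, 0 <= g x)%R -> \int[S]_x (g x)%:E <= 1 ->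
      \int[S]_x (g x)%:E \is a fin_num.
    move=> g0 g1; rewrite ge0_fin_numE; first exact: (le_lt_trans g1 (ltry 1)).
    by apply: integral_ge0 => x _; rewrite lee_fin.
  have le1 (S : probability (borel V) R) : \int[S]_x (h x)%:E <= 1.
    by rewrite -(sum1 S) leeDl// integral_ge0// => x _; rewrite lee_fin.
  have le1' (S : probability (borel V) R) : \int[S]_x (1 - h x)%:E <= 1.
    by rewrite -(sum1 S) leeDr// integral_ge0// => x _; rewrite lee_fin.
  apply/eqP; rewrite eq_le (PQ L)//=.
  have := PQ L (fun x => 1 - h x)%R L0 _ _.
  have := sum1 P; have := sum1 Q; move: (fin P h h0 (le1 P)) (fin Q h h0 (le1 Q)).
  move: (fin P _ h1 (le1' P)) (fin Q _ h1 (le1' Q)).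
  do 4 move=> /fineK <-.
  rewrite -!EFinD !lee_fin => -[q1] [p1] /(_ _ _) h2.
  have : (fine (\int[P]_x (1 - h x)%:E) <= fine (\int[Q]_x (1 - h x)%:E))%R.
    apply: h2 => [x|x y]; first by rewrite h1/= gerBl.
    by have := hL y x; rewrite distrC; lra.
  by lra.
have open_le (S S' : probability (borel V) R) (G : set V) : open G ->
    (forall m, \int[S]_x (infconv (\1_G : V -> R) m x)%:E
             = \int[S']_x (infconv (\1_G : V -> R) m x)%:E) -> S G <= S' G.
  move=> oG SS'; have mG := open_borel oG.
  rewrite -(setIT (G : set (borel V))) -!integral_indic//.
  apply: (@integral_le_infconv _ _ S (\1_G)) => // [x|m].
    exact: indic_lower_semicontinuous.
  rewrite SS'; apply: ge0_le_integral => //.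
  - by move=> x _; rewrite lee_fin infconv_ge0.
  - by apply: continuous_measurable_EFin; exact: infconv_continuous.
  - by apply/measurable_EFinP; exact: measurable_indic.
  - by move=> x _; rewrite lee_fin infconv_le.
apply: (@measure_unique _ _ (borel V) (@open V) (fun=> setT)) => //.
- by move=> A A' oA oA'; exact: openI.
- by move=> _; exact: openT.
- by rewrite bigcup_const//; exists 0%N.
- move=> G oG.
  have eqm m : \int[P]_x (infconv (\1_G : V -> R) m x)%:E
             = \int[Q]_x (infconv (\1_G : V -> R) m x)%:E.
    apply: (PQeq m%:R) => // [x|]; last exact: infconv_lipschitz.
    have G0 y : (0 <= \1_G y :> R)%R by [].
    by rewrite infconv_ge0//= (le_trans (infconv_le G0 m x)).
  by apply/eqP; rewrite eq_le !open_le.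
- by move=> _; apply: (le_lt_trans (probability_le1 P measurableT)); exact: ltry.
Qed.

End lipschitz_determine.

(** * Norming functionals *)

Section hahn_banach.
Context (R : realType) (V : normedModType R).
Implicit Types (x y v w : V) (G : set (V * R)).

Definition contractive_functional (phi : V -> R) := [/\
  forall x y, phi (x + y) = phi x + phi y,
  forall a x, phi (a *: x) = a * phi x &
  forall x, `|phi x| <= `|x|].

(** Graphs of linear functionals on subspaces, dominated by the norm.
    Functionality of the graph is a consequence of the bound. *)
Let dominated_graph G :=
  (forall a x r y s, G (x, r) -> G (y, s) -> G (a *: x + y, a * r + s)) /\
  (forall x r, G (x, r) -> r <= `|x|).

Let dominated_graph0 G x r : dominated_graph G -> G (x, r) -> G (0, 0).
Proof.
move=> [Glin _] Gx; have := Glin (-1) _ _ _ _ Gx Gx.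
by rewrite scaleN1r mulN1r !addNr.
Qed.

Let dominated_graphZ G a x r : dominated_graph G -> G (x, r) -> G (a *: x, a * r).
Proof.
move=> Gd Gx; have := Gd.1 a _ _ _ _ Gx (dominated_graph0 Gd Gx).
by rewrite !addr0.
Qed.

Let dominated_graphD G x r y s : dominated_graph G -> G (x, r) -> G (y, s) ->
  G (x + y, r + s).
Proof.
by move=> Gd Gx Gy; have := Gd.1 1 _ _ _ _ Gx Gy; rewrite scale1r mul1r.
Qed.

Let dominated_graph_fun G x r s : dominated_graph G -> G (x, r) -> G (x, s) ->
  r = s.
Proof.
move=> Gd; have le t t' : G (x, t) -> G (x, t') -> t <= t'.
  move=> Gt Gt'; have := Gd.1 (-1) _ _ _ _ Gt' Gt.
  by rewrite scaleN1r mulN1r addNr => /Gd.2; rewrite normr0 addrC subr_le0.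
by move=> Gr Gs; apply/eqP; rewrite eq_le !le.
Qed.

Let extend G w c : set (V * R) :=
  [set z | exists x r t, G (x, r) /\ z = (x + t *: w, r + t * c)].

(** The value [c] at [w] must lie between [r - `|x - w|] and [`|y + w| - s] for all
    [(x, r)] and [(y, s)] in the graph; the triangle inequality leaves room. *)
Let dominated_graph_extend G v0 r0 w : dominated_graph G -> G (v0, r0) ->
  exists c, dominated_graph (extend G w c).
Proof.
move=> Gd G0.
pose S := [set z.2 - `|z.1 - w| | z in G].
have Sub y s : G (y, s) -> ubound S (`|y + w| - s).
  move=> Gy _ [[x r] /= Gx <-]; rewrite lerBlDr addrAC lerBrDr.
  apply: (le_trans (Gd.2 _ _ (dominated_graphD Gd Gx Gy))).
  have -> : x + y = (y + w) + (x - w) by rewrite addrACA subrr addr0 addrC.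
  exact: ler_normD.
have S0 : S !=set0 by exists (r0 - `|v0 - w|), (v0, r0).
have hS : has_ubound S by exists (`|v0 + w| - r0); exact: Sub.
exists (sup S).
have up y s : G (y, s) -> s + sup S <= `|y + w|.
  by move=> Gy; rewrite addrC -lerBrDr; apply: ge_sup => //; exact: Sub.
have down x r : G (x, r) -> r - sup S <= `|x - w|.
  move=> Gx; rewrite lerBlDr -lerBlDl.
  by apply: ub_le_sup => //; exists (x, r).
split=> [a x r y s [x1 [r1 [t1 [G1 [-> ->]]]]] [x2 [r2 [t2 [G2 [-> ->]]]]]|].
  exists (a *: x1 + x2), (a * r1 + r2), (a * t1 + t2); split.
    exact: Gd.1.
  congr (_, _); last by rewrite mulrDl mulrDr addrACA mulrA.
  by rewrite scalerDl scalerDr addrACA scalerA.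
move=> x r [x1 [r1 [t [G1 [-> ->]]]]].
have normM u (z : V) : 0 < u -> u * `|z| = `|u *: z|.
  by move=> u0; rewrite normrZ gtr0_norm.
have [t0|t0|->] := ltgtP t 0; last by rewrite scale0r mul0r !addr0; exact: Gd.2.
- have t'0 : 0 < - t by rewrite oppr_gt0.
  have := down _ _ (dominated_graphZ (- t)^-1 Gd G1).
  rewrite -(ler_pM2l t'0) mulrBr mulrA divff ?gt_eqF// mul1r mulNr opprK.
  rewrite normM// scalerBr scalerA divff ?gt_eqF// scale1r.
  by rewrite scaleNr opprK.
- have := up _ _ (dominated_graphZ t^-1 Gd G1).
  rewrite -(ler_pM2l t0) mulrDr mulrA divff ?gt_eqF// mul1r.
  by rewrite normM// scalerDr scalerA divff ?gt_eqF// scale1r.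
Qed.

(** The Hahn-Banach theorem, for extensions of the functional that maps
    [a *: v] to [a * `|v|]. *)
Lemma norming_functional v : exists2 phi, contractive_functional phi &
  phi v = `|v|.
Proof.
(* The empty graph is admitted because it is the union of the empty chain. *)
pose ok G := G = set0 \/ (dominated_graph G /\ G (v, `|v|)).
have [F Fok Ftot|A [Aok Amax]] := @Zorn_bigcup (V * R)%type ok.
  have [[X FX [z Xz]]|F0] := pselect (exists2 X, F X & X !=set0); last first.
    left; rewrite predeqE => z; split => // -[X FX Xz].
    by apply: F0; exists X => //; exists z.
  have Fd Y (y : V * R) : F Y -> Y y -> dominated_graph Y /\ Y (v, `|v|).
    by move=> /Fok[->//|].
  right; split; last by exists X => //; exact: (Fd _ _ FX Xz).2.
  split=> [a x r y s [X1 FX1 X1x] [X2 FX2 X2y]|x r [X1 FX1 X1x]].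
    have [X12|X21] := Ftot _ _ FX1 FX2.
      exists X2 => //; apply: (Fd _ _ FX2 X2y).1.1 => //; exact: X12.
    exists X1 => //; apply: (Fd _ _ FX1 X1x).1.1 => //; exact: X21.
  exact: (Fd _ _ FX1 X1x).1.2 X1x.
have line_ok : ok [set (a *: v, a * `|v|) | a in setT].
  right; split; last by exists 1 => //; rewrite scale1r mul1r.
  split=> [a x r y s [b _ [<- <-]] [c _ [<- <-]]|x r [b _ [<- <-]]].
    by exists (a * b + c) => //; rewrite scalerDl scalerA mulrDl mulrA.
  by rewrite normrZ ler_wpM2r// ler_norm.
have [Ad Av] : dominated_graph A /\ A (v, `|v|).
  case: Aok => // A0; exfalso; apply: (Amax _ _ line_ok); rewrite A0.
  by split => // /(_ (0 *: v, 0 * `|v|))[]; exists 0.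
have Atot w : exists r, A (w, r).
  apply: contrapT => Aw.
  have [c Ac] := dominated_graph_extend w Ad Av.
  apply: (Amax (extend A w c)).
    split=> [|ext_sub].
      move=> [x r] Ax; exists x, r, 0; split => //.
      by rewrite scale0r mul0r !addr0.
    apply: Aw; exists c; apply: ext_sub; exists 0, 0, 1; split.
      exact: dominated_graph0 Ad Av.
    by rewrite scale1r mul1r !add0r.
  right; split => //; exists v, `|v|, 0; split => //.
  by rewrite scale0r mul0r !addr0.
pose phi w := projT1 (cid (Atot w)).
have phiP w : A (w, phi w) by rewrite /phi; case: cid.
have phiE w r : A (w, r) -> phi w = r by exact: dominated_graph_fun.
have phiZ a x : phi (a *: x) = a * phi x.
  by apply: phiE; exact: dominated_graphZ.
exists phi; last exact: phiE.
split=> [x y|//|x]; first by apply: phiE; exact: dominated_graphD.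
rewrite ler_norml (Ad.2 _ _ (phiP x)) andbT lerNl -[leRHS]normrN.
apply: Ad.2; rewrite -scaleN1r -(mulN1r (phi x)) -phiZ; exact: phiP.
Qed.

End hahn_banach.

(** * Bochner integrals that are zero *)

Section simple_integral_functional.
Context d (T : measurableType d) (R : realType) (V : normedModType R).
Context (P : probability T R) (phi : V -> R).
Hypothesis phi_cf : contractive_functional phi.
Local Open Scope ereal_scope.

Lemma contractive_functional0 : phi 0%R = 0%R.
Proof. by have [_ phiZ _] := phi_cf; rewrite -(scale0r 0%R) phiZ mul0r. Qed.

(** No sigma-algebra on [V] is involved: the function is glued from finitely many
    of the [F ^~ v]. *)
Lemma simple_function_measurable (s : T -> V) (F : T -> V -> R) :
  simple_function s -> (forall v, measurable_fun setT (F ^~ v)) ->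
  measurable_fun setT (fun z => F z (s z)).
Proof.
move=> [sfin smeas] mF _ Y mY; rewrite setTI.
have -> : (fun z => F z (s z)) @^-1` Y =
    \bigcup_(v in range s) (s @^-1` [set v] `&` (F ^~ v) @^-1` Y).
  rewrite predeqE => z; split => [Yz|[v _ [/= <- //]]].
  by exists (s z) => //; exists z.
apply: fin_bigcup_measurable => // v _; apply: measurableI => //.
by rewrite -[X in measurable X]setTI; exact: mF.
Qed.

Lemma functional_simple_integral (s : T -> V) : simple_function s ->
  (phi (simple_integral P s))%:E = \int[P]_z (phi (s z))%:E.
Proof.
move=> simple_s; have [sfin smeas] := simple_s; have [phiD phiZ _] := phi_cf.
rewrite /simple_integral fsbig_finite//=.
rewrite (big_morph phi phiD contractive_functional0) -sumEFin.
pose r : seq V := finmap.enum_fset (fset_set (range s)).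
have -> : \int[P]_z (phi (s z))%:E =
    \int[P]_(z in \big[setU/set0]_(v <- r) s @^-1` [set v]) (phi (s z))%:E.
  congr (integral _ _ _); rewrite predeqE => z; split => // _.
  rewrite -bigcup_seq; exists (s z) => //=.
  by rewrite in_fset_set// inE; exists z.
rewrite integral_bigsetU_EFin//; last 3 first.
- exact: finmap.fset_uniq.
- by move=> u v _ _ [z [/= <- <-]].
- apply/measurable_EFinP; apply: measurable_funTS.
  exact: (@simple_function_measurable s (fun _ v => phi v)).
apply: eq_bigr => v _.
transitivity (\int[P]_(z in s @^-1` [set v]) (phi v)%:E).
  rewrite integral_cst// phiZ EFinM fineK 1?muleC//; exact: fin_num_measure.
by apply: eq_integral => z; rewrite inE /= => ->.
Qed.

Lemma functional_simple_integral_dist (f s : T -> V) :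
  simple_function s -> (forall v, measurable_fun setT (fun z => `|f z - v|%R)) ->
  P.-integrable setT (EFin \o (phi \o f)) ->
  \int[P]_z (`|f z - s z|)%:E < +oo ->
  `|\int[P]_z (phi (f z))%:E - (phi (simple_integral P s))%:E|
    <= \int[P]_z (`|f z - s z|)%:E.
Proof.
move=> simple_s mf iphi fs; have [phiD phiZ phi_le] := phi_cf.
have phiB x y : (phi (x - y) = phi x - phi y)%R.
  by rewrite phiD -scaleN1r phiZ mulN1r.
have mfs : measurable_fun setT (fun z => `|f z - s z|%R).
  exact: (@simple_function_measurable s (fun z v => `|f z - v|)%R).
have mphis : measurable_fun setT (fun z => phi (s z)).
  exact: (@simple_function_measurable s (fun _ v => phi v)).
have mphif : measurable_fun setT (phi \o f).
  by have /integrableP[/measurable_EFinP] := iphi.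
have ile : P.-integrable setT (fun z => (`|f z - s z|)%:E).
  apply/integrableP; split; first exact/measurable_EFinP.
  by under eq_integral do rewrite abse_EFin normr_id.
have idiff : P.-integrable setT (fun z => (phi (f z - s z))%:E).
  apply: le_integrable ile => //.
    apply/measurable_EFinP; under eq_fun do rewrite phiB.
    exact: measurable_funB.
  by move=> z _; rewrite !abse_EFin normr_id lee_fin.
have iphis : P.-integrable setT (EFin \o (phi \o s)).
  rewrite (_ : _ \o _ = (EFin \o (phi \o f)) \- (fun z => (phi (f z - s z))%:E)).
    exact: integrableB.
  by apply/funext => z /=; rewrite -EFinB phiB opprB addrC subrK.
rewrite functional_simple_integral// -integralB_EFin//.
apply: le_trans (le_abse_integral _ _ _) _ => //.
  by apply/measurable_EFinP; exact: measurable_funB.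
apply: ge0_le_integral => //.
- by apply/measurable_EFinP/measurableT_comp => //; exact: measurable_funB.
- exact/measurable_EFinP.
- by move=> z _; rewrite -EFinB abse_EFin lee_fin -phiB.
Qed.

End simple_integral_functional.

Section bochner_zero.
Context (R : realType) (W V : normedModType R) (P : probability (borel W) R).
Context (f : W -> V).
Hypothesis f_cont : continuous f.
Hypothesis f_int : (\int[P]_z (`|f z|)%:E < +oo)%E.
Local Open Scope ereal_scope.

Let dist_cont v : continuous (fun z => `|f z - v|%R).
Proof. by move=> z; apply: cvg_norm; apply: cvgB; [exact: f_cont|exact: cvg_cst]. Qed.

Let dist_meas v : measurable_fun setT (fun z : borel W => `|f z - v|%R).
Proof. exact: continuous_measurable_real (@dist_cont v). Qed.

Lemma contractive_functional_continuous (phi : V -> R) :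
  contractive_functional phi -> continuous phi.
Proof.
move=> [phiD phiZ phi_le].
apply: (@lipschitz_for_continuous _ _ 1%R) => // x y.
rewrite mul1r -lerBlDl; apply: le_trans (phi_le (x - y)%R).
by rewrite phiD -(scaleN1r y) phiZ mulN1r ler_norm.
Qed.

Lemma contractive_functional_integrable (phi : V -> R) :
  contractive_functional phi -> P.-integrable setT (EFin \o (phi \o f)).
Proof.
move=> cphi; apply: (continuous_dominated_integrable (G := fun z => `|f z|%R)) => //.
- move=> z; apply: continuous_comp; first exact: f_cont.
  exact: contractive_functional_continuous.
- by move=> z; apply: cvg_norm; exact: f_cont.
- by move=> z; have [_ _] := cphi; exact.
Qed.

Lemma Bochner_integral0_functional (phi : V -> R) :
  Bochner_integral P f 0%R -> contractive_functional phi ->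
  \int[P]_z (phi (f z))%:E = 0.
Proof.
move=> [s [simple_s _ s_cvg s0]] cphi.
have iphi := contractive_functional_integrable cphi.
have [_ _ phi_le] := cphi.
suff : `|\int[P]_z (phi (f z))%:E| <= 0.
  by move=> le0; apply/eqP; rewrite -abse_eq0 eq_le le0 abse_ge0.
apply/lee_addgt0Pr => e e0; rewrite add0e.
have e20 : (0 < e / 2)%R by rewrite divr_gt0.
have near1 : \forall n \near \oo, \int[P]_z (`|f z - s n z|)%:E < (e / 2)%:E.
  exact: (s_cvg _ (@nbhs_open_ereal_lt _ 0%R (fun=> e / 2)%R e20)).
have near2 : \forall n \near \oo, (`|simple_integral P (s n)| < e / 2)%R.
  have /cvgrPdist_lt/(_ _ e20) := s0.
  by apply: filterS => n; rewrite sub0r normrN.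
have [n [n1 n2]] := filter_ex (filterI near1 near2).
have := functional_simple_integral_dist cphi (simple_s n) dist_meas iphi
  (lt_trans n1 (ltry _)).
move: (integrable_fin_num measurableT iphi) => /fineK <-.
move=> /le_lt_trans /(_ n1); rewrite -EFinB !abse_EFin lte_fin lee_fin => n3.
have := phi_le (simple_integral P (s n)).
have := ler_distD (phi (simple_integral P (s n))) (fine (\int[P]_z (phi (f z))%:E)) 0%R.
rewrite !subr0; lra.
Qed.

Section approximation.
Context (b : nat -> V).
Hypothesis b_dense : forall x e, (0 < e)%R -> exists i, (`|x - b i| < e)%R.

(** A point nearest to [f z] among [0] and the first [m] terms of [b]; the
    presence of [0] makes [`|f z|] bound the error. *)
Fixpoint nearest m (z : W) : V :=
  if m is m'.+1 then
    if (`|f z - b m'| < `|f z - nearest m' z|)%R then b m' else nearest m' z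
  else 0%R.

Let err m z : R := (`|f z - nearest m z|)%R.

Let errS m z : err m.+1 z = Num.min (`|f z - b m|)%R (err m z).
Proof. by rewrite /err /= /Order.min; case: ifPn. Qed.

Let err_cont m : continuous (err m).
Proof.
elim: m => [|m IH] z; first exact: dist_cont.
rewrite (_ : err m.+1 = (fun z => `|f z - b m|)%R \min err m).
  by apply: continuous_min; [exact: dist_cont|exact: IH].
by apply/funext => x; rewrite errS.
Qed.

Let err_ge0 m z : (0 <= err m z)%R. Proof. by rewrite /err. Qed.

Let err_le m z : (err m z <= `|f z|)%R.
Proof.
elim: m => [|m IH]; first by rewrite /err /= subr0.
by rewrite errS ge_min IH orbT.
Qed.

Let err_cvg z : err m z @[m --> \oo] --> (0 : R)%R.
Proof.
apply/cvgrPdist_lt => e e0; have [i ie] := b_dense (f z) e0.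
exists i.+1 => // m /= im; rewrite sub0r normrN ger0_norm//.
rewrite -(subnKC im); elim: (m - i.+1)%N => [|k IH].
  by rewrite addn0 errS gt_min ie.
by rewrite addnS errS gt_min IH orbT.
Qed.

Let nearest_simple m : simple_function (nearest m : borel W -> V).
Proof.
elim: m => [|m [fin_m meas_m]].
  split=> [|v].
    by apply: sub_finite_set (finite_set1 (0%R : V)) => _ [z _ <-].
  have [->|v0] := eqVneq v 0%R.
    by rewrite (_ : _ @^-1` _ = setT)//; rewrite predeqE.
  rewrite (_ : _ @^-1` _ = set0)//; rewrite predeqE => z; split => //= z0.
  by rewrite z0 eqxx in v0.
split=> [|v].
  apply: (@sub_finite_set _ _ (range (nearest m) `|` [set b m])).
    move=> _ [z _ <-] /=; case: ifP => _; first by right.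
    by left; exists z.
  by rewrite finite_setU.
pose A : set (borel W) := [set z | `|f z - b m| < err m z]%R.
have mA : measurable A.
  rewrite -[A]setTI; apply: measurable_fun_ltr => //.
  exact: continuous_measurable_real (@err_cont m).
rewrite (_ : _ @^-1` _ = (A `&` [set _ | b m = v]) `|`
    (~` A `&` nearest m @^-1` [set v])).
  apply: measurableU; apply: measurableI => //; last exact: measurableC.
  have [bv|bv] := pselect (b m = v).
    by rewrite (_ : [set _ | _] = setT)// predeqE.
  by rewrite (_ : [set _ | _] = set0)// predeqE.
rewrite predeqE => z; rewrite /A /=; case: ifPn => zb; split.
- by left.
- by case=> -[].
- by right; split => //; exact/negP.
- by case=> -[zb']; rewrite ?zb' in zb.
Qed.

Let err_int_cvg : \int[P]_z (err m z)%:E @[m --> \oo] --> 0.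
Proof.
have errm m : measurable_fun setT (fun z : borel W => (err m z)%:E).
  exact: continuous_measurable_EFin (@err_cont m).
have nf_cont : continuous (fun z => `|f z|%R).
  by move=> z; apply: cvg_norm; exact: f_cont.
have [||||_ _] := @dominated_convergence _ _ _ P setT measurableT
  (fun m z => (err m z)%:E) (cst 0) (fun z => (`|f z|)%:E) errm.
- exact: measurable_cst.
- by apply: aeW => z _; apply: cvg_EFin; [exact: nearW|exact: err_cvg].
- apply: (@continuous_dominated_integrable _ _ P _ (fun z => `|f z|%R)) => //.
  by move=> z; rewrite normr_id.
- apply: aeW => z m _; rewrite abse_EFin lee_fin ger0_norm//; exact: err_le.
by rewrite integral0.
Qed.

(** The norm of a simple integral is its value under a norming functional, so
    scalar integrals control it. *)
Lemma functional_Bochner_integral0 :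
  (forall phi : V -> R, contractive_functional phi ->
    \int[P]_z (phi (f z))%:E = 0) ->
  Bochner_integral P f 0%R.
Proof.
move=> phi0; exists nearest; split.
- exact: nearest_simple.
- apply: aeW => z; apply/cvgrPdist_lt => e e0.
  have /cvgrPdist_lt/(_ _ e0) := @err_cvg z.
  by apply: filterS => m; rewrite sub0r normrN ger0_norm.
- exact: err_int_cvg.
apply/cvgrPdist_lt => e e0.
have : \forall m \near \oo, \int[P]_z (err m z)%:E < e%:E.
  exact: (err_int_cvg (@nbhs_open_ereal_lt _ 0%R (fun=> e) e0)).
apply: filterS => m me; rewrite sub0r normrN.
have [phi cphi phiv] := norming_functional (simple_integral P (nearest m)).
have := functional_simple_integral_dist cphi (nearest_simple m) dist_meas
  (contractive_functional_integrable cphi) (lt_trans me (ltry _)).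
rewrite phi0// phiv sub0e abseN abse_EFin normr_id => /le_lt_trans/(_ me).
by rewrite lte_fin.
Qed.

End approximation.
End bochner_zero.

(** * Limits of martingale couplings *)

Lemma prod_sequentially_complete (R : realType) (V : normedModType R) :
  (forall u : nat -> V, cauchy (u @ \oo) -> cvg (u @ \oo)) ->
  forall u : nat -> ((V * V)%type : normedModType R),
  cauchy (u @ \oo) -> cvg (u @ \oo).
Proof.
move=> V_complete u /cauchyP cu.
have fst_cvg : cvg ((fun n => (u n).1) @ \oo).
  apply: V_complete; apply: cauchy_exP => e e0.
  have [z ze] := cu e e0; exists z.1.
  have {}ze : \forall n \near \oo, ball z e (u n) := ze.
  suff : \forall n \near \oo, ball z.1 e (u n).1 by [].
  by apply: filterS ze => n [].
have snd_cvg : cvg ((fun n => (u n).2) @ \oo).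
  apply: V_complete; apply: cauchy_exP => e e0.
  have [z ze] := cu e e0; exists z.2.
  have {}ze : \forall n \near \oo, ball z e (u n) := ze.
  suff : \forall n \near \oo, ball z.2 e (u n).2 by [].
  by apply: filterS ze => n [].
move: fst_cvg snd_cvg => /cvg_ex[l1 ul1] /cvg_ex[l2 ul2].
apply/cvg_ex; exists (l1, l2).
rewrite (_ : u = fun n => ((u n).1, (u n).2)); first exact: cvg_pair.
by apply/funext => n; case: (u n).
Qed.

Section sum_norm_theory.
Context (R : realType) (B : normedModType R).
Local Open Scope ereal_scope.

Lemma sum_norm_ge_norm (z : (B * B)%type) : (`|z| <= sum_norm z)%R.
Proof. by rewrite prod_normE ge_max /sum_norm lerDl lerDr !normr_ge0. Qed.

Lemma sum_normN (z : (B * B)%type) : sum_norm (- z)%R = sum_norm z.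
Proof. by rewrite /sum_norm !normrN. Qed.

Lemma sum_norm_continuous : continuous (@sum_norm R B).
Proof.
by move=> z; apply: cvgD; apply: cvg_norm; [exact: cvg_fst|exact: cvg_snd].
Qed.

Definition growth_bound K (z : (B * B)%type) : R := (K * (1 + sum_norm z))%R.

Lemma growth_bound_continuous K : continuous (growth_bound K).
Proof.
move=> z; apply: cvgMr; apply: cvgD; first exact: cvg_cst.
exact: sum_norm_continuous.
Qed.

Lemma coupling_growth_bound K (mu nu : probability (borel B) R) gamma :
  (0 <= K)%R -> couplings mu nu gamma ->
  \int[gamma]_z (growth_bound K z)%:E =
  K%:E * (1 + (\int[mu]_x (`|x|)%:E + \int[nu]_x (`|x|)%:E)).
Proof.
move=> K0 gmn.
have sn0 (z : (B * B)%type) : (0 <= sum_norm z)%R by rewrite addr_ge0.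
have nc : continuous (fun x : B => `|x|%R) by move=> x; exact: cvg_norm.
under eq_integral do rewrite EFinM.
rewrite ge0_integralZl_EFin//; last 2 first.
- by move=> z _; rewrite lee_fin addr_ge0.
- apply: (@continuous_measurable_EFin _ (B * B)%type) => z.
  by apply: cvgD; [exact: cvg_cst|exact: sum_norm_continuous].
congr (_ * _); under eq_integral do rewrite EFinD.
rewrite ge0_integralD//; last 2 first.
- by move=> z _; rewrite lee_fin.
- apply: (@continuous_measurable_EFin _ (B * B)%type).
  exact: sum_norm_continuous.
rewrite (@integral_cst_borel _ (B * B)%type); congr (_ + _).
under eq_integral do rewrite EFinD.
rewrite ge0_integralD//; last 2 first.
- apply: (@continuous_measurable_EFin _ (B * B)%type) => z.
  by apply: cvg_norm; exact: cvg_fst.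
- apply: (@continuous_measurable_EFin _ (B * B)%type) => z.
  by apply: cvg_norm; exact: cvg_snd.
by rewrite (coupling_integral_fst gmn nc) ?(coupling_integral_snd gmn nc).
Qed.

Lemma coupling_growth_bound_lty K (mu nu : probability (borel B) R) gamma :
  (0 <= K)%R -> couplings mu nu gamma ->
  finite_first_moment (fun x : B => `|x|)%R mu ->
  finite_first_moment (fun x : B => `|x|)%R nu ->
  \int[gamma]_z (growth_bound K z)%:E < +oo.
Proof.
move=> K0 gmn muoo nuoo; rewrite (coupling_growth_bound K0 gmn).
apply: lte_mul_pinfty => //; rewrite lte_add_pinfty// ?ltry//.
exact: lte_add_pinfty.
Qed.

Section near_limit.
Context (F : set_system nat) {FF : ProperFilter F}.
Context (mu nu : probability (borel B) R).
Context (mu_ nu_ : nat -> probability (borel B) R).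
Hypothesis mu_near : coupling_near (fun x : B => `|x|%R) F mu_ mu.
Hypothesis nu_near : coupling_near (fun x : B => `|x|%R) F nu_ nu.

Let norm_continuous : continuous (fun x : B => `|x|%R).
Proof. by move=> x; exact: cvg_norm. Qed.

(** The marginals determine the integral of [sum_norm], which rules out an
    escape of first moments along the couplings. *)
Lemma growth_bound_limit K (pi : probability (borel (B * B)%type) R) pi_ :
  (0 <= K)%R -> couplings mu nu pi ->
  (forall n, couplings (mu_ n) (nu_ n) (pi_ n)) ->
  forall e : R, (0 < e)%R -> \forall n \near F,
    \int[pi_ n]_z (growth_bound K z)%:E <=
    \int[pi]_z (growth_bound K z)%:E + e%:E.
Proof.
move=> K0 pic pinc e e0.
have K1 : (0 < K + 1)%R by rewrite ltr_wpDl.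
pose d : R := (e / (K + 1) / 2)%R.
have d0 : (0 < d)%R by rewrite !divr_gt0.
have normL (x y : B) : (`|x| <= `|y| + 1 * `|x - y|)%R.
  by rewrite mul1r addrC -lerBlDr lerB_dist.
have norm_le (P : probability (borel B) R) P_ :
    coupling_near (fun x : B => `|x|%R) F P_ P ->
    \forall n \near F, \int[P_ n]_x (`|x|)%:E <= \int[P]_x (`|x|)%:E + d%:E.
  move=> cP; have := coupling_near_le_limit norm_continuous (fun=> lexx _) (@normrN _ _)
    (FF := @filter_filter _ _ FF) cP ler01 norm_continuous (@normr_ge0 _ _) normL d0.
  by apply: filterS => n [].
apply: filterS2 (norm_le _ _ mu_near) (norm_le _ _ nu_near) => n mun nun.
rewrite (coupling_growth_bound K0 pic) (coupling_growth_bound K0 (pinc n)).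
have int0 (P : probability (borel B) R) : 0 <= \int[P]_x (`|x|)%:E.
  by apply: integral_ge0 => x _; rewrite lee_fin.
apply: (@le_trans _ _ (K%:E * (1 + (\int[mu]_x (`|x|)%:E + \int[nu]_x (`|x|)%:E)
    + (d + d)%:E))).
  apply: lee_wpmul2l; first by rewrite lee_fin.
  have add_le (a b a' b' t : \bar R) : a <= a' + t -> b <= b' + t ->
      1 + (a + b) <= 1 + (a' + b') + (t + t).
    by move=> aa' bb'; rewrite -addeA; apply: leeD2l; rewrite addeACA leeD.
  by rewrite EFinD; exact: add_le.
rewrite ge0_muleDr; last 2 first.
- by rewrite adde_ge0// adde_ge0.
- by rewrite lee_fin addr_ge0// ltW.
apply: leeD2l; rewrite -EFinM lee_fin /d -splitr mulrA ler_pdivrMr// mulrC.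
by rewrite ler_wpM2l ?lerDl// ltW.
Qed.

(** The integrand [g z.1 *: (z.2 - z.1)] is continuous and dominated by the growth
    bound, so its scalar images have integral zero in the limit. *)
Lemma lsc_limit_martingale (pi : probability (borel (B * B)%type) R) pi_ :
  separable_space B ->
  finite_first_moment (fun x : B => `|x|)%R mu ->
  finite_first_moment (fun x : B => `|x|)%R nu ->
  (forall n, finite_first_moment (fun x : B => `|x|)%R (mu_ n)) ->
  (forall n, finite_first_moment (fun x : B => `|x|)%R (nu_ n)) ->
  lsc_limit F pi_ pi -> couplings mu nu pi ->
  (forall n, martingale_couplings (mu_ n) (nu_ n) (pi_ n)) ->
  martingale_couplings mu nu pi.
Proof.
move=> /separable_dense_sequence[b b_dense] muoo nuoo munoo nunoo lpi pic pim.
split=> // g gc [M gM].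
pose f (z : (B * B)%type) := (g z.1 *: (z.2 - z.1))%R.
have fc : continuous f.
  move=> z; apply: cvgZ.
    by apply: continuous_comp; [exact: cvg_fst|exact: gc].
  by apply: cvgB; [exact: cvg_snd|exact: cvg_fst].
have M0 : (0 <= M)%R by exact: le_trans (gM 0%R).
have f_le z : (`|f z| <= growth_bound M z)%R.
  rewrite normrZ ler_pM// (le_trans (ler_normB _ _))// /sum_norm addrC.
  by rewrite lerDr.
have pinc n : couplings (mu_ n) (nu_ n) (pi_ n) := (pim n).1.
have f_lty (P Q : probability (borel B) R) gamma : couplings P Q gamma ->
    finite_first_moment (fun x : B => `|x|)%R P ->
    finite_first_moment (fun x : B => `|x|)%R Q ->
    \int[gamma]_z (`|f z|)%:E < +oo.
  move=> gPQ Poo Qoo; apply: le_lt_trans (coupling_growth_bound_lty M0 gPQ Poo Qoo).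
  apply: (@ge0_le_integral_borel _ (B * B)%type gamma (fun z => `|f z|%R)) => //.
  - by move=> z; apply: cvg_norm; exact: fc.
  - exact: growth_bound_continuous.
apply: (functional_Bochner_integral0 fc (f_lty _ _ _ pic muoo nuoo) b_dense).
move=> phi cphi; have [_ _ phi_le] := cphi.
apply: (lsc_limit_integral_eq0 (filter_filter (F := F)) lpi _
  (@growth_bound_continuous M)).
- move=> z; apply: continuous_comp; first exact: fc.
  exact: contractive_functional_continuous.
- by move=> z; rewrite (le_trans (phi_le _)).
- by move=> n; exact: coupling_growth_bound_lty (pinc n) _ _.
- exact: coupling_growth_bound_lty pic _ _.
- exact: growth_bound_limit.
- move=> n; apply: (Bochner_integral0_functional fc
    (f_lty _ _ _ (pinc n) (munoo n) (nunoo n)) _ cphi).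
  by apply: (pim n).2 => //; exists M.
Qed.

End near_limit.
End sum_norm_theory.

Section coupling_compactness.
Context (R : realType) (B : completeNormedModType R).
Local Open Scope ereal_scope.

(** The marginals of the narrow limit are determined on Lipschitz functions, where
    both the marginals of [pi_ n] and the limit laws can be evaluated. *)
Lemma lsc_limit_couplings (U : set_system nat) (mu nu : probability (borel B) R)
    (mu_ nu_ : nat -> probability (borel B) R) pi_ :
  separable_space B -> UltraFilter U ->
  coupling_near (fun x : B => `|x|%R) U mu_ mu ->
  coupling_near (fun x : B => `|x|%R) U nu_ nu ->
  (forall n, couplings (mu_ n) (nu_ n) (pi_ n)) ->
  exists2 pi, couplings mu nu pi & lsc_limit U pi_ pi.
Proof.
move=> /separable_dense_sequence[b b_dense] UU mun nun pinc.
have UF : Filter U := @filter_filter _ _ (@ultra_proper _ _ UU).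
have [pi lpi] := @narrow_cluster_point _ (B * B)%type 
  (prod_sequentially_complete (fun u => @cauchy_cvg B (u @ \oo) _)) U UU pi_
  (pair_sequence b)
  (couplings_tight UF pinc (coupling_near_tight b_dense UF mun)
    (coupling_near_tight b_dense UF nun)).
have nc : continuous (fun x : B => `|x|%R) by move=> x; exact: cvg_norm.
have marginal (P : probability (borel B) R) P_
    (T : borel (B * B)%type -> borel B) (mT : measurable_fun setT T) :
    continuous (T : (B * B)%type -> B) ->
    (forall z w : (B * B)%type, `|T z - T w| <= `|z - w|)%R ->
    coupling_near (fun x : B => `|x|%R) U P_ P ->
    (forall n (h : B -> R), continuous h -> (forall x, 0 <= h x)%R ->
      \int[pi_ n]_z (h (T z))%:E = \int[P_ n]_x (h x)%:E) ->
    forall A : set (borel B), measurable A -> pi (T @^-1` A) = P A.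
  move=> cT T1 cP intT; pose law := distribution pi (mfun_Sub (mem_set mT)).
  apply: (@probability_eq_lipschitz _ _ law P) => L h L0 h01 hL.
  have h0 x : (0 <= h x)%R by case/andP: (h01 x).
  have hc := lipschitz_for_continuous L0 hL.
  rewrite ge0_integral_distribution; last 2 first.
  - exact: continuous_measurable_EFin.
  - by move=> x; rewrite lee_fin.
  apply/lee_addgt0Pr => e e0.
  have Pfin : \int[P]_x (h x)%:E \is a fin_num.
    rewrite ge0_fin_numE; last by apply: integral_ge0 => x _; rewrite lee_fin.
    apply: (@le_lt_trans _ _ 1); last exact: ltry.
    rewrite -(integral_cst_borel P 1).
    apply: (ge0_le_integral_borel P h0 hc) => [x|x]; first exact: cvg_cst.
    by case/andP: (h01 x).
  rewrite -(fineK Pfin) -EFinD; apply: (lpi (h \o T)) => [z|z|].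
  - exact: h0.
  - by apply: continuous_comp; [exact: cT|exact: hc].
  - have := coupling_near_le_limit nc (fun=> lexx _) (@normrN _ _) (FF := UF) cP L0 hc h0 hL e0.
    by apply: filterS => n [le_n _]; rewrite intT// EFinD fineK.
exists pi => // A mA; split.
- apply: (marginal mu mu_ fst (@fst_measurable_borel R B)) => //.
  + by move=> z; exact: cvg_fst.
  + by move=> z w; rewrite prod_normE le_max lexx.
  + by move=> n h hc h0; exact: coupling_integral_fst (pinc n) hc h0.
- apply: (marginal nu nu_ snd (@snd_measurable_borel R B)) => //.
  + by move=> z; exact: cvg_snd.
  + by move=> z w; rewrite prod_normE le_max lexx orbT.
  + by move=> n h hc h0; exact: coupling_integral_snd (pinc n) hc h0.
Qed.

End coupling_compactness.

Lemma frequently_filter (S : set nat) :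
  (forall N, exists2 n, (N <= n)%N & S n) -> ProperFilter (within S \oo).
Proof.
move=> Sfreq; apply: Build_ProperFilter => [[N _ NS]].
by have [n Nn Sn] := Sfreq N; exact: (NS n Nn).
Qed.

(** * Stability of the value *)

Theorem lemma20 (R : realType) (B : completeNormedModType R)
    (B_separable : separable_space B)
    (mu nu : probability (borel B) R)
    (mu_ nu_ : nat -> probability (borel B) R)
    (mu_P1 : finite_first_moment (fun x : B => `|x|) mu)
    (nu_P1 : finite_first_moment (fun x : B => `|x|) nu)
    (mu_n_P1 : forall n, finite_first_moment (fun x : B => `|x|) (mu_ n))
    (nu_n_P1 : forall n, finite_first_moment (fun x : B => `|x|) (nu_ n))
    (mu_cvg : cvg_wasserstein1 (fun x : B => `|x|) mu_ mu)
    (nu_cvg : cvg_wasserstein1 (fun x : B => `|x|) nu_ nu)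
    (pit : probability (borel (B * B)%type) R)
    (pi_ : nat -> probability (borel (B * B)%type) R)
    (pit_mart : martingale_couplings mu nu pit)
    (pi_mart : forall n, martingale_couplings (mu_ n) (nu_ n) (pi_ n))
    (pi_cvg : cvg_wasserstein1 (@sum_norm R B) pi_ pit)
    (c : (B * B)%type -> R)
    (c_ge0 : forall z, 0 <= c z)
    (c_cont : continuous c)
    (c_growth : sublinear_growth c) :
  let P_ := fun n => mot_value c (mu_ n) (nu_ n) in
  let P := mot_value c mu nu in
  [/\ (cost c pit >= limn_esup P_)%E,
      (limn_esup P_ >= limn_einf P_)%E,
      (limn_einf P_ >= P)%E
    & mot_minimiser c mu nu pit ->
      forall phi : nat -> nat, increasing_seq phi ->
        P_ (phi k) @[k --> \oo] --> limn_einf P_ ->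
        P_ (phi k) @[k --> \oo] --> P].
Proof.
move=> P_ P.
have norm_cont : continuous (fun x : B => `|x|) by move=> x; exact: cvg_norm.
have near_mu (F : set_system nat) : Filter F -> \oo `<=` F ->
    coupling_near (fun x : B => `|x|) F mu_ mu.
  by move=> FF ooF; exact: wasserstein1_coupling_near.
have near_nu (F : set_system nat) : Filter F -> \oo `<=` F ->
    coupling_near (fun x : B => `|x|) F nu_ nu.
  by move=> FF ooF; exact: wasserstein1_coupling_near.
have oo_within S : \oo `<=` within S \oo.
  by move=> A; apply: filterS => n An _.
have [C cC] := c_growth.
have C0 : 0 <= C.
  have := cC 0 0; rewrite normr0 !addr0 mulr1; exact: le_trans.
have c_le z : `|c z| <= growth_bound C z.
  by case: z => x y; rewrite (le_trans (cC x y))// /growth_bound /sum_norm addrA.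
have upper : (limn_esup P_ <= cost c pit)%E.
  have c_int : pit.-integrable setT (EFin \o c).
    apply: (continuous_dominated_integrable c_cont
      (@growth_bound_continuous R B C) c_le).
    exact: coupling_growth_bound_lty C0 pit_mart.1 mu_P1 nu_P1.
  have cost_fin : cost c pit = (fine (cost c pit))%:E.
    by rewrite fineK//; exact: integrable_fin_num.
  rewrite cost_fin; apply/lee_addgt0Pr => e e0; rewrite -EFinD leNgt.
  apply/negP => /limn_esup_gt_frequently Pfreq.
  pose F := within [set n | ((fine (cost c pit) + e)%:E < P_ n)%E] \oo.
  have FF : ProperFilter F by exact: frequently_filter.
  have pi_lsc : lsc_limit F pi_ pit.
    apply: (@coupling_near_lsc_limit _ _ (@sum_norm R B)).
    - exact: sum_norm_continuous.
    - exact: sum_norm_ge_norm.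
    - exact: sum_normN.
    - by apply: wasserstein1_coupling_near pi_cvg; exact: oo_within.
  have : ((fine (cost c pit) + e)%:E <= cost c pit)%E.
    apply: (lsc_limit_integral_ge filter_filter pi_lsc c_cont
      (@growth_bound_continuous R B C) c_le).
    - move=> n.
      exact: coupling_growth_bound_lty C0 (pi_mart n).1 (mu_n_P1 n) (nu_n_P1 n).
    - exact: coupling_growth_bound_lty C0 pit_mart.1 mu_P1 nu_P1.
    - apply: (growth_bound_limit (near_mu F _ _) (near_nu F _ _) C0 pit_mart.1);
        do ?exact: oo_within.
      by move=> n; exact: (pi_mart n).1.
    - apply: filterS (near_withinT _ _) => n /= Pn.
      apply: (le_trans (ltW Pn)); apply: ereal_inf_lbound.
      by exists (pi_ n) => //; exact: pi_mart.
  by rewrite {2}cost_fin lee_fin gerDl leNgt e0.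
have lower : (P <= limn_einf P_)%E.
  have P_ge0 n : (0 <= P_ n)%E.
    apply: le_ereal_inf_tmp => _ [pi _ <-].
    by apply: integral_ge0 => z _; rewrite lee_fin.
  have inf_ge0 : (0 <= limn_einf P_)%E.
    rewrite limn_einf_lim; apply: lime_ge; first exact: is_cvg_einfs.
    by apply: nearW => n; apply: le_ereal_inf_tmp => _ [k _ <-].
  have [->|inf_lty] := eqVneq (limn_einf P_) +oo%E; first exact: leey.
  have inf_fin : limn_einf P_ = (fine (limn_einf P_))%:E.
    by rewrite fineK// ge0_fin_numE// ltey.
  rewrite inf_fin; apply/lee_addgt0Pr => e e0; rewrite -EFinD.
  set a := fine (limn_einf P_) + e.
  have Pfreq : forall N, exists2 n, (N <= n)%N & (P_ n < a%:E)%E.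
    by apply: limn_einf_lt_frequently; rewrite inf_fin lte_fin ltrDl.
  have := @frequently_filter [set n | (P_ n < a%:E)%E] Pfreq.
  set F := within _ _ => FF; have [U [U_ultra FU]] := ultraFilterLemma FF.
  have U_filter : ProperFilter U by exact: ultra_proper.
  have ooU : \oo `<=` U by move=> A /(oo_within [set n | (P_ n < a%:E)%E])/FU.
  (* Outside the chosen indices any martingale coupling will do, and [pi_ n] is
     one. *)
  have : forall n, exists pi, martingale_couplings (mu_ n) (nu_ n) pi /\
      ((P_ n < a%:E)%E -> (cost c pi <= a%:E)%E).
    move=> n; have [Pn|Pn] := ltP (P_ n) a%:E.
      have [_ [pi pim <-] pia] := ereal_inf_lt Pn.
      by exists pi; split => // _; exact: ltW.
    by exists (pi_ n); split; [exact: pi_mart|].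
  move=> /choice[rho rhoP].
  have rho_mart n : martingale_couplings (mu_ n) (nu_ n) (rho n) := (rhoP n).1.
  have [pi pic pi_lsc] := lsc_limit_couplings B_separable U_ultra
    (near_mu U _ ooU) (near_nu U _ ooU) (fun n => (rho_mart n).1).
  have pi_mart' : martingale_couplings mu nu pi.
    exact: (lsc_limit_martingale (near_mu U _ ooU) (near_nu U _ ooU) B_separable
      mu_P1 nu_P1 mu_n_P1 nu_n_P1 pi_lsc pic rho_mart).
  apply: (@le_trans _ _ (cost c pi)).
    by apply: ereal_inf_lbound; exists pi.
  have F_lt : \forall n \near F, (P_ n < a%:E)%E by exact: near_withinT.
  apply: pi_lsc => //; apply: FU.
  suff : \forall n \near F, (cost c (rho n) <= a%:E)%E by [].
  by apply: filterS F_lt => n Pn; exact: (rhoP n).2.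
split=> //; first exact: limn_einf_sup.
move=> [_ pit_min] phi _; suff -> : limn_einf P_ = P by [].
apply/eqP; rewrite eq_le lower andbT.
apply: (le_trans (limn_einf_sup P_)); apply: (le_trans upper).
by apply: le_ereal_inf_tmp => _ [pi pim <-]; exact: pit_min.
Qed.
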